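(* Assume $P$ satisfies SYM and BAL. Then $d_{\rm cond}\le d_{\rm KS}$.
   Context: Fix a finite set $\Omega$ with $q=|\Omega|$, an integer $k\ge2$, a finite set $\Psi$ of functions $\Omega^k\to[0,1]$ closed under permutations of coordinates ($\psi^\theta(\sigma)=\psi(\sigma_{\theta(1)},\dots,\sigma_{\theta(k)})$), and a probability distribution $P$ on $\Psi$ with $P(\psi)>0$ for all $\psi$ and $\min_{\psi,\sigma}\psi(\sigma)<\max_{\psi,\sigma}\psi(\sigma)$. $\boldsymbol\psi$ is a sample from $P$, $\xi=q^{-k}\sum_{\sigma\in\Omega^k}\mathbb E[\boldsymbol\psi(\sigma)]$. SYM: for all $i\in[k]$, $\omega\in\Omega$, $\psi\in\Psi$, $\sum_{\tau\in\Omega^k}\mathbf 1\{\tau_i=\omega\}\psi(\tau)=q^{k-1}\xi$, and $P(\psi)=P(\psi^\theta)$ for all permutations $\theta$. BAL: $\phi(\mu)=\sum_{\tau\in\Omega^k}\mathbb E[\boldsymbol\psi(\tau)]\prod_{i=1}^k\mu(\tau_i)$ is concave on the set of probability distributions $\mu$ on $\Omega$ and maximised at the uniform distribution. For $\psi\in\Psi$ let $\Phi_\psi\in\mathbb R^{\Omega\times\Omega}$, $\Phi_\psi(\omega,\omega')=q^{1-k}\xi^{-1}\sum_{\tau\in\Omega^k}\mathbf 1\{\tau_1=\omega,\tau_2=\omega'\}\psi(\tau)$, and $\Xi=\mathbb E[\Phi_{\boldsymbol\psi}\otimes\Phi_{\boldsymbol\psi}]$ acting on $\mathbb R^q\otimes\mathbb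 R^q$. With $\mathbf 1$ the all-ones vector, $\mathcal E=\{z\in\mathbb R^q\otimes\mathbb R^q:\langle z,\mathbf 1\otimes y\rangle=\langle z,y\otimes\mathbf 1\rangle=0\ \forall y\in\mathbb R^q\}$ and $d_{\rm KS}=\big((k-1)\max_{x\in\mathcal E,\|x\|=1}\langle\Xi x,x\rangle\big)^{-1}$ ($=\infty$ if the maximum is $0$). $d_{\rm cond}$: with $\Lambda(x)=x\ln x$, $\Lambda(0)=0$, $\mathcal P^2_*(\Omega)$ the probability measures $\pi$ on the simplex $\mathcal P(\Omega)$ with $\int\mu(\omega)d\pi(\mu)=1/q$ for all $\omega$, $\gamma\sim{\rm Po}(d)$, $\rho_1,\rho_2,\dots$ i.i.d. from $\pi$, $\psi_1,\psi_2,\dots$ i.i.d. from $P$, all independent, $\mathcal B(d,P,\pi)=\mathbb E\big[q^{-1}\xi^{-\gamma}\Lambda\big(\sum_{\sigma\in\Omega}\prod_{i=1}^{\gamma}\sum_{\tau\in\Omega^k}\mathbf 1\{\tau_k=\sigma\}\psi_i(\tau)\prod_{j=1}^{k-1}\rho_{ki+j}(\tau_j)\big)-\frac{d(k-1)}{k\xi}\Lambda\big(\sum_{\tau\in\Omega^k}\psi_1(\tau)\prod_{j=1}^k\rho_j(\tau_j)\big)\big]$ and $d_{\rm cond}=\inf\{d>0:\sup_{\pi\in\mathcal P^2_*(\Omega)}\mathcal B(d,P,\pi)>\ln q+\frac dk\ln\xi\}$. *)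

(* Defs.v *)
From HB Require Import structures.
From mathcomp Require Import all_boot all_order all_algebra all_fingroup.
From mathcomp Require Import all_classical all_reals all_analysis.
Set Implicit Arguments. Unset Strict Implicit. Unset Printing Implicit Defensive.
Import Order.TTheory GRing.Theory Num.Theory.
Import numFieldNormedType.Exports.
Local Open Scope classical_set_scope.
Local Open Scope ring_scope.

(* Conventions.  Omega : finType, q = #|Omega|.  Omega^k = {ffun 'I_k -> Omega}
   (coordinate i+1 of the paper = index i : 'I_k here).  Psi is a finite index
   type with an injective evaluation map [psi : Psi -> {ffun 'I_k -> Omega} -> R],
   so that Psi is identified with a finite set of functions Omega^k -> R.
   P : Psi -> R is the probability distribution on Psi. *)

Definition coordIs (Omega : finType) (k : nat) (tau : {ffun 'I_k -> Omega})
  (n : nat) (w : Omega) : bool :=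
  [exists i : 'I_k, (val i == n) && (tau i == w)].

Definition permTup (Omega : finType) (k : nat) (theta : {perm 'I_k})
  (sigma : {ffun 'I_k -> Omega}) : {ffun 'I_k -> Omega} :=
  [ffun i => sigma (theta i)].

Definition xi (R : realType) (Omega : finType) (k : nat) (Psi : finType)
  (psi : Psi -> {ffun 'I_k -> Omega} -> R) (P : Psi -> R) : R :=
  (#|Omega|%:R ^- k) * \sum_(sigma : {ffun 'I_k -> Omega}) \sum_(p : Psi) P p * psi p sigma.

Definition standing (R : realType) (Omega : finType) (k : nat) (Psi : finType)
  (psi : Psi -> {ffun 'I_k -> Omega} -> R) (P : Psi -> R) : Prop :=
  (2 <= k)%N /\
  injective psi /\
  (forall p sigma, 0 <= psi p sigma <= 1) /\
  (forall p (theta : {perm 'I_k}), exists p',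
      forall sigma, psi p' sigma = psi p (permTup theta sigma)) /\
  (forall p, 0 < P p) /\ \sum_(p : Psi) P p = 1 /\
  (exists p sigma p' sigma', psi p sigma < psi p' sigma').

Definition SYM (R : realType) (Omega : finType) (k : nat) (Psi : finType)
  (psi : Psi -> {ffun 'I_k -> Omega} -> R) (P : Psi -> R) : Prop :=
  (forall (i : 'I_k) (w : Omega) (p : Psi),
      \sum_(tau : {ffun 'I_k -> Omega} | tau i == w) psi p tau
        = #|Omega|%:R ^+ k.-1 * xi psi P)
  /\ (forall (p p' : Psi) (theta : {perm 'I_k}),
      (forall sigma, psi p' sigma = psi p (permTup theta sigma)) -> P p = P p').

Definition simplex (R : realType) (Omega : finType) (mu : Omega -> R) : Prop :=
  (forall w, 0 <= mu w) /\ \sum_(w : Omega) mu w = 1.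

Definition phiBAL (R : realType) (Omega : finType) (k : nat) (Psi : finType)
  (psi : Psi -> {ffun 'I_k -> Omega} -> R) (P : Psi -> R) (mu : Omega -> R) : R :=
  \sum_(tau : {ffun 'I_k -> Omega}) (\sum_(p : Psi) P p * psi p tau) *
     \prod_(i : 'I_k) mu (tau i).

Definition BAL (R : realType) (Omega : finType) (k : nat) (Psi : finType)
  (psi : Psi -> {ffun 'I_k -> Omega} -> R) (P : Psi -> R) : Prop :=
  (forall (mu nu : Omega -> R) (t : R), simplex mu -> simplex nu -> 0 <= t <= 1 ->
      t * phiBAL psi P mu + (1 - t) * phiBAL psi P nu
        <= phiBAL psi P (fun w => t * mu w + (1 - t) * nu w))
  /\ (forall mu : Omega -> R, simplex mu ->
      phiBAL psi P mu <= phiBAL psi P (fun _ => #|Omega|%:R^-1)).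

Definition Phi (R : realType) (Omega : finType) (k : nat) (Psi : finType)
  (psi : Psi -> {ffun 'I_k -> Omega} -> R) (P : Psi -> R) (p : Psi) (w w' : Omega) : R :=
  (#|Omega|%:R ^- k.-1) * (xi psi P)^-1 *
  \sum_(tau : {ffun 'I_k -> Omega} | coordIs tau 0 w && coordIs tau 1 w') psi p tau.

(* <Xi x, x> with Xi = E[Phi (x) Phi], (A (x) B)_{(a,b),(c,e)} = A_{ac} B_{be} *)
Definition XiQuad (R : realType) (Omega : finType) (k : nat) (Psi : finType)
  (psi : Psi -> {ffun 'I_k -> Omega} -> R) (P : Psi -> R) (x : Omega -> Omega -> R) : R :=
  \sum_(a : Omega) \sum_(b : Omega) \sum_(c : Omega) \sum_(e : Omega)
    (\sum_(p : Psi) P p * (Phi psi P p a c * Phi psi P p b e)) * x c e * x a b.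

Definition inE (R : realType) (Omega : finType) (z : Omega -> Omega -> R) : Prop :=
  forall y : Omega -> R,
    \sum_(a : Omega) \sum_(b : Omega) z a b * (1 * y b) = 0 /\
    \sum_(a : Omega) \sum_(b : Omega) z a b * (y a * 1) = 0.

Definition unitNorm (R : realType) (Omega : finType) (z : Omega -> Omega -> R) : Prop :=
  \sum_(a : Omega) \sum_(b : Omega) z a b ^+ 2 = 1.

(* max_{x in E, ||x|| = 1} <Xi x, x>  (the set is compact, so sup = max) *)
Definition maxXi (R : realType) (Omega : finType) (k : nat) (Psi : finType)
  (psi : Psi -> {ffun 'I_k -> Omega} -> R) (P : Psi -> R) : \bar R :=
  ereal_sup [set (XiQuad psi P x)%:E | x in [set x | inE x /\ unitNorm x]].

Definition d_KS (R : realType) (Omega : finType) (k : nat) (Psi : finType)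
  (psi : Psi -> {ffun 'I_k -> Omega} -> R) (P : Psi -> R) : \bar R :=
  match maxXi psi P with
  | (m%:E)%E => if m == 0 then (+oo)%E else ((k.-1%:R * m)^-1)%:E
  | (+oo)%E => 0%E
  | (-oo)%E => (+oo)%E (* empty set: impossible under the standing assumptions *)
  end.

Definition Lambda (R : realType) (x : R) : R := if x == 0 then 0 else x * ln x.

(* Expectation over n i.i.d. samples rho_1, ..., rho_n from pi, where pi is the
   law of rho under the probability mu:  the n-fold iterated integral
   E[f [:: rho_1; ...; rho_n]]. *)
Fixpoint iidInt (R : realType) (Omega : finType) (dT : measure_display)
  (T : measurableType dT) (mu : probability T R) (rho : T -> Omega -> R)
  (n : nat) (f : seq (Omega -> R) -> R) : R :=
  match n with
  | 0 => f [::]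
  | n'.+1 => Rintegral mu setT (fun t => iidInt mu rho n' (fun s => f (rho t :: s)))
  end.

Definition poissonW (R : realType) (d : R) (g : nat) : R :=
  expR (- d) * d ^+ g / (g`!)%:R.

(* first summand, conditionally on gamma = g, psi_1..psi_g = ps and the sample
   s = (rho_{k+1},...) arranged as s`_(i*(k-1)+j) = rho_{k(i+1)+(j+1)} *)
Definition Zfirst (R : realType) (Omega : finType) (k : nat) (Psi : finType)
  (psi : Psi -> {ffun 'I_k -> Omega} -> R) (g : nat) (ps : {ffun 'I_g -> Psi})
  (s : seq (Omega -> R)) : R :=
  \sum_(sigma : Omega) \prod_(i : 'I_g)
     \sum_(tau : {ffun 'I_k -> Omega} | coordIs tau k.-1 sigma)
        psi (ps i) tau *
        \prod_(j : 'I_k | (val j < k.-1)%N) (nth (fun _ => 0) s (i * k.-1 + j)%N) (tau j).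

Definition Bfirst_g (R : realType) (Omega : finType) (k : nat) (Psi : finType)
  (psi : Psi -> {ffun 'I_k -> Omega} -> R) (P : Psi -> R) (dT : measure_display)
  (T : measurableType dT) (mu : probability T R) (rho : T -> Omega -> R)
  (d : R) (g : nat) : R :=
  poissonW d g *
  \sum_(ps : {ffun 'I_g -> Psi}) (\prod_(i : 'I_g) P (ps i)) *
     iidInt mu rho (g * k.-1)
       (fun s => #|Omega|%:R^-1 * (xi psi P) ^- g * Lambda (Zfirst psi ps s)).

Definition Bfun (R : realType) (Omega : finType) (k : nat) (Psi : finType)
  (psi : Psi -> {ffun 'I_k -> Omega} -> R) (P : Psi -> R) (dT : measure_display)
  (T : measurableType dT) (mu : probability T R) (rho : T -> Omega -> R)
  (d : R) : R :=
  limn (series (Bfirst_g psi P mu rho d))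
  - d * k.-1%:R / (k%:R * xi psi P) *
    \sum_(p : Psi) P p *
      iidInt mu rho k (fun s => Lambda (\sum_(tau : {ffun 'I_k -> Omega})
          psi p tau * \prod_(j : 'I_k) (nth (fun _ => 0) s j) (tau j))).

(* pi in P^2_*(Omega), represented as the law of rho under mu *)
Definition P2star (R : realType) (Omega : finType) (dT : measure_display)
  (T : measurableType dT) (mu : probability T R) (rho : T -> Omega -> R) : Prop :=
  (forall t, simplex (rho t)) /\
  (forall w, measurable_fun setT (fun t => rho t w)) /\
  (forall w, Rintegral mu setT (fun t => rho t w) = #|Omega|%:R^-1).

Definition d_cond (R : realType) (Omega : finType) (k : nat) (Psi : finType)
  (psi : Psi -> {ffun 'I_k -> Omega} -> R) (P : Psi -> R) : \bar R :=
  ereal_inf [set d%:E | d in [set d : R | 0 < d /\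
    exists (dT : measure_display) (T : measurableType dT) (mu : probability T R)
           (rho : T -> Omega -> R),
      P2star mu rho /\
      Bfun psi P mu rho d > ln #|Omega|%:R + d / k%:R * ln (xi psi P)]].

(* Main.v *)
Require Import Defs.
From HB Require Import structures.
From mathcomp Require Import all_boot all_order all_algebra all_fingroup.
From mathcomp Require Import all_classical all_reals all_analysis.
From mathcomp Require Import ring lra.
Import Order.TTheory GRing.Theory Num.Theory.
Import numFieldNormedType.Exports.
Local Open Scope classical_set_scope.
Local Open Scope ring_scope.
Set Implicit Arguments. Unset Strict Implicit. Unset Printing Implicit Defensive.

(** Take for [pi] the law of [rho = (1 + eps x) / q], where [x] is a finitely
supported centred random vector with coordinate sum 0 and covariance [C].
Write [Xi] for [E(Phi (x) Phi)] and [b = d (k - 1)].  Up to positive factors, the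
normalized partition functions in the two terms of [B(d, P, pi)] are [1 + W]
with [E W = 0] and, by SYM, [W = O(eps^2)], so that the entropies [E Lambda(1 + W)]
equal [E W^2 / 2 + O(eps^6)].  The second moments only involve [C], and the terms
of order [eps^4] add up to
  [B - ln q - d/k ln xi = eps^4 b / (4 q^2) (b |Xi C|^2 - <C, Xi C>) + ...].
Each conditional entropy given [gamma] is nonnegative, hence the Poisson sum may be
truncated and no uniformity in [gamma] is required.

It remains to find a positive semidefinite [C] with [<C, Xi C> < b |Xi C|^2]
as soon as [1 < b <Xi z, z>] for some unit [z] in [E].  Otherwise [Xi^n C] decays like
[b^-n] for every positive semidefinite [C].  As [Xi] is completely positive,
[Xi^n z] is dominated by [Xi^n C] for the projection [C] orthogonal to [1], whereas
[<z, Xi^n z> >= <z, Xi z>^n] for [n] a power of 2 by Cauchy-Schwarz. *)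

(** * Completely positive maps and Gram matrices *)

Section Forms.
Variables (R : realType) (I : finType).
Implicit Types x y z : I -> I -> R.

Definition dot x y : R := \sum_a \sum_b x a b * y a b.

Lemma dotC x y : dot x y = dot y x.
Proof. by apply: eq_bigr => a _; apply: eq_bigr => b _; rewrite mulrC. Qed.

Lemma dot_ge0 x : 0 <= dot x x.
Proof. by apply: sumr_ge0 => a _; apply: sumr_ge0 => b _; rewrite -expr2 sqr_ge0. Qed.

Lemma cauchy_schwarz_sum (J : finType) (f g : J -> R) :
  (\sum_j f j * g j) ^+ 2 <= (\sum_j f j ^+ 2) * (\sum_j g j ^+ 2).
Proof.
set A := \sum_j f j ^+ 2; set B := \sum_j g j ^+ 2; set S := \sum_j f j * g j.
have A0 : 0 <= A by apply: sumr_ge0 => j _; exact: sqr_ge0.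
have E t : 0 <= t ^+ 2 * A - 2 * t * S + B.
  have -> : t ^+ 2 * A - 2 * t * S + B = \sum_j (t * f j - g j) ^+ 2.
    rewrite /A /B /S !mulr_sumr -sumrB -big_split /=.
    by apply: eq_bigr => j _; ring.
  by apply: sumr_ge0 => j _; exact: sqr_ge0.
have [A_eq0|A_neq0] := eqVneq A 0.
  have f0 j : f j = 0.
    apply/eqP; rewrite -sqrf_eq0; apply/eqP.
    by apply: (psumr_eq0P _ A_eq0) => // i _; exact: sqr_ge0.
  by rewrite A_eq0 mul0r /S big1 ?expr0n // => j _; rewrite f0 mul0r.
have Agt0 : 0 < A by rewrite lt_neqAle eq_sym A_neq0.
(* [S / A] minimizes the quadratic polynomial in [t]; nonnegativity there is the discriminant
   inequality. *)
have := E (S / A); rewrite -(pmulr_rge0 _ Agt0).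
suff -> : A * ((S / A) ^+ 2 * A - 2 * (S / A) * S + B) = A * B - S ^+ 2.
  by rewrite subr_ge0.
by field.
Qed.

Lemma dotE x y : dot x y = \sum_(p : I * I) x p.1 p.2 * y p.1 p.2.
Proof. by rewrite /dot pair_bigA. Qed.

Lemma dot_cauchy_schwarz x y : dot x y ^+ 2 <= dot x x * dot y y.
Proof.
rewrite !dotE; apply: le_trans (cauchy_schwarz_sum _ _) _.
by rewrite le_eqVlt; apply/orP; left; apply/eqP; congr (_ * _);
  apply: eq_bigr => p _; rewrite expr2.
Qed.

Definition quad x (y w : I -> R) : R := \sum_a \sum_b x a b * y a * w b.

End Forms.

(** * Power iteration for a completely positive map *)

Section PowerMethod.
Variables (R : realType) (I S : finType) (P : S -> R) (A : S -> I -> I -> R).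
Implicit Types (x z : I -> I -> R) (u v w y : I -> R).
Hypothesis P_ge0 : forall p, 0 <= P p.

(** With tensors read as matrices [z], this is the mean of [A p z (A p)^T], a completely positive
    map whose Kraus operators are the [A p] up to weights. *)
Definition superop z : I -> I -> R := fun a b =>
  \sum_c \sum_e (\sum_p P p * (A p a c * A p b e)) * z c e.

Local Notation T := superop.

(** These are the positive semidefinite matrices annihilating constants. The factorization is what
    later realizes [z] as a covariance, up to a factor. *)
Definition gram z : Prop := exists (J : finType) (u : J -> I -> R),
  (forall j, \sum_a u j a = 0) /\ forall a b, z a b = \sum_j u j a * u j b.

(** Moves the Kraus operators to the test vectors, so that an inequality between quadratic forms
    passes through [superop] termwise in [p]. *)
Lemma quad_superop z y w :
  quad (T z) y w = \sum_p P p *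
    quad z (fun c => \sum_a A p a c * y a) (fun e => \sum_b A p b e * w b).
Proof.
rewrite /quad /T.
transitivity (\sum_a \sum_b \sum_c \sum_e \sum_p
    P p * (A p a c * A p b e) * z c e * y a * w b).
  apply: eq_bigr => a _; apply: eq_bigr => b _.
  rewrite -mulrA mulr_suml; apply: eq_bigr => c _.
  rewrite mulr_suml; apply: eq_bigr => e _.
  by rewrite !mulr_suml; apply: eq_bigr => p _; ring.
under eq_bigr => a _ do under eq_bigr => b _ do under eq_bigr => c _ do rewrite exchange_big.
under eq_bigr => a _ do under eq_bigr => b _ do rewrite exchange_big.
under eq_bigr => a _ do rewrite exchange_big.
rewrite exchange_big; apply: eq_bigr => p _ /=.
rewrite mulr_sumr.
under [RHS]eq_bigr => c _ do rewrite mulr_sumr.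
transitivity (\sum_a \sum_c \sum_e \sum_b
    P p * (A p a c * A p b e) * z c e * y a * w b).
  apply: eq_bigr => a _; rewrite exchange_big; apply: eq_bigr => c _ /=.
  by rewrite exchange_big.
rewrite exchange_big; apply: eq_bigr => c _ /=.
rewrite exchange_big; apply: eq_bigr => e _ /=.
rewrite exchange_big !mulr_sumr; apply: eq_bigr => b _ /=.
by rewrite mulr_suml mulr_sumr; apply: eq_bigr => a _; ring.
Qed.

Hypothesis A_sum : forall p c, \sum_a A p a c = 1.

(** The new vectors are [sqrt (P p)] times [A p] applied to [u j]; unit column sums keep their
    coordinate sums at zero. *)
Lemma superop_gram z : gram z -> gram (T z).
Proof.
move=> [J [u [u0 uz]]].
exists (S * J)%type, (fun pj a => Num.sqrt (P pj.1) * \sum_c A pj.1 a c * u pj.2 c).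
split=> [[p j]|a b] /=.
  rewrite -mulr_sumr exchange_big /=; under eq_bigr do rewrite -mulr_suml A_sum mul1r.
  by rewrite u0 mulr0.
rewrite -(pair_bigA _ (fun p j => Num.sqrt (P p) * (\sum_c A p a c * u j c) *
   (Num.sqrt (P p) * (\sum_c A p b c * u j c)))) /=.
transitivity (\sum_c \sum_e \sum_p \sum_j P p * (A p a c * u j c) * (A p b e * u j e)).
  apply: eq_bigr => c _; apply: eq_bigr => e _.
  rewrite uz mulr_suml; apply: eq_bigr => p _; rewrite mulr_sumr.
  by apply: eq_bigr => j _; ring.
under [LHS]eq_bigr => c _ do rewrite exchange_big.
rewrite exchange_big; apply: eq_bigr => p _ /=.
under [LHS]eq_bigr => c _ do rewrite exchange_big.
rewrite exchange_big; apply: eq_bigr => j _ /=.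
have -> (s1 s2 : R) : Num.sqrt (P p) * s1 * (Num.sqrt (P p) * s2) = P p * (s1 * s2).
  by rewrite mulrACA -expr2 sqr_sqrtr.
rewrite mulr_suml mulr_sumr; apply: eq_bigr => c _.
by rewrite !mulr_sumr; apply: eq_bigr => e _; ring.
Qed.

Hypothesis A_sym : forall a b c e,
  \sum_p P p * (A p a c * A p b e) = \sum_p P p * (A p c a * A p e b).

Lemma superop_sym (x y : I -> I -> R) : dot (T x) y = dot x (T y).
Proof.
rewrite /dot /T.
transitivity (\sum_a \sum_b \sum_c \sum_e
  (\sum_p P p * (A p c a * A p e b)) * x c e * y a b).
  apply: eq_bigr => a _; apply: eq_bigr => b _.
  rewrite mulr_suml; apply: eq_bigr => c _; rewrite mulr_suml.
  by apply: eq_bigr => e _; rewrite A_sym.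
transitivity (\sum_c \sum_e \sum_a \sum_b
  (\sum_p P p * (A p c a * A p e b)) * x c e * y a b); last first.
  apply: eq_bigr => c _; apply: eq_bigr => e _.
  rewrite mulr_sumr; apply: eq_bigr => a _; rewrite mulr_sumr.
  by apply: eq_bigr => b _; ring.
under eq_bigr => a _ do rewrite exchange_big.
rewrite exchange_big; apply: eq_bigr => c _ /=.
under eq_bigr => a _ do rewrite exchange_big.
by rewrite exchange_big.
Qed.

(* The hypothesis says that the block matrix with diagonal blocks [z] and off-diagonal
   blocks [- x] is positive semidefinite. *)
Lemma superop_dominated x z :
  (forall y w, 2 * quad x y w <= quad z y y + quad z w w) ->
  forall y w, 2 * quad (T x) y w <= quad (T z) y y + quad (T z) w w.
Proof.
move=> H y w; rewrite !quad_superop mulr_sumr -big_split /=.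
by apply: ler_sum => p _; rewrite mulrCA -mulrDr ler_wpM2l.
Qed.

(** The orthogonal projection onto the complement of the constants, where the power iteration
    starts. *)
Definition centering : I -> I -> R := fun a b => (a == b)%:R - #|I|%:R^-1.

Hypothesis I_gt0 : (0 < #|I|)%N.

Let q_neq0 : #|I|%:R != 0 :> R. Proof. by rewrite pnatr_eq0 -lt0n. Qed.

Lemma sum_centering a : \sum_b centering a b = 0.
Proof.
rewrite /centering sumrB (bigD1 a) //= eqxx big1 => [|b ba]; last first.
  by rewrite eq_sym (negbTE ba).
by rewrite addr0 sumr_const -[#|I|%:R^-1 *+ _]mulr_natr mulVf ?subrr.
Qed.

Lemma centering_sym a b : centering a b = centering b a.
Proof. by rewrite /centering eq_sym. Qed.

Lemma centering_idem a b : \sum_j centering j a * centering j b = centering a b.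
Proof.
under eq_bigr => j _ do rewrite {1}/centering mulrBl.
rewrite sumrB -mulr_sumr.
under [X in _ - _ * X]eq_bigr => j _ do rewrite centering_sym.
rewrite sum_centering mulr0 subr0 (bigD1 a) //= eqxx mul1r big1 ?addr0 // => j ja.
by rewrite (negbTE ja) mul0r.
Qed.

Lemma gram_centering : gram centering.
Proof.
exists I, centering; split=> [j|a b]; first exact: sum_centering.
by rewrite centering_idem.
Qed.

Lemma quad_centering y :
  quad centering y y = \sum_j (\sum_a centering j a * y a) ^+ 2.
Proof.
rewrite /quad.
transitivity (\sum_a \sum_b \sum_j (centering j a * y a) * (centering j b * y b)).
  apply: eq_bigr => a _; apply: eq_bigr => b _.
  rewrite -centering_idem !mulr_suml; apply: eq_bigr => j _; ring.
under eq_bigr => a _ do rewrite exchange_big.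
rewrite exchange_big; apply: eq_bigr => j _ /=.
rewrite expr2 mulr_suml; apply: eq_bigr => a _.
by rewrite mulr_sumr.
Qed.

(** Since [x] annihilates constants on both sides, [y] and [w] may be replaced by their centered
    versions [Y] and [W]; then Cauchy-Schwarz gives at most [|Y| |W|], and the arithmetic mean of
    squares bounds this. *)
Lemma unit_dominated x :
  (forall a, \sum_b x a b = 0) -> (forall b, \sum_a x a b = 0) -> dot x x = 1 ->
  forall y w, 2 * quad x y w <= quad centering y y + quad centering w w.
Proof.
move=> x0r x0c x1 y w; rewrite !quad_centering.
pose Y j := \sum_a centering j a * y a; pose W j := \sum_a centering j a * w a.
have mean u j : \sum_a centering j a * u a = u j - (\sum_a u a) / #|I|%:R.
  rewrite /centering; under eq_bigr do rewrite mulrBl.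
  rewrite sumrB -mulr_sumr [_^-1 * _]mulrC; congr (_ - _).
  rewrite (bigD1 j) //= eqxx mul1r big1 ?addr0 // => i ij.
  by rewrite eq_sym (negbTE ij) mul0r.
have -> : quad x y w = \sum_(p : I * I) x p.1 p.2 * (Y p.1 * W p.2).
  rewrite -(pair_bigA _ (fun a b => x a b * (Y a * W b))) /=.
  set my := (\sum_a y a) / #|I|%:R; set mw := (\sum_a w a) / #|I|%:R.
  have E a b : x a b * (Y a * W b) =
     x a b * y a * w b - (x a b * w b) * my - (x a b * y a) * mw + x a b * (my * mw).
    by rewrite /Y /W !mean -/my -/mw; ring.
  under eq_bigr => a _ do under eq_bigr => b _ do rewrite E.
  under eq_bigr => a _.
    rewrite big_split /= !sumrB -!mulr_suml x0r !mul0r !subr0 addr0; over.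
  rewrite /= sumrB -mulr_suml [X in _ - X * _]exchange_big /=.
  rewrite [X in _ - X * _]big1 => [|b _]; last by rewrite -mulr_suml x0c mul0r.
  by rewrite mul0r subr0.
set s := \sum_p _; set a := \sum_j _; set b := \sum_j _.
have a0 : 0 <= a by apply: sumr_ge0 => j _; exact: sqr_ge0.
have b0 : 0 <= b by apply: sumr_ge0 => j _; exact: sqr_ge0.
have : s ^+ 2 <= a * b.
  apply: le_trans (cauchy_schwarz_sum _ _) _.
  have -> : \sum_(p : I * I) x p.1 p.2 ^+ 2 = 1.
    by rewrite -x1 dotE; apply: eq_bigr => p _; rewrite expr2.
  rewrite mul1r -(pair_bigA _ (fun a b => (Y a * W b) ^+ 2)) /=.
  rewrite /a mulr_suml; apply: ler_sum => i _; rewrite /b mulr_sumr.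
  by apply: ler_sum => j _; rewrite exprMn.
clearbody s a b => sab; have [s0|s0] := leP s 0; first by lra.
have ab2 := sqr_ge0 (a - b).
by rewrite -(@ler_pXn2r _ 2) // ?nnegrE; nra.
Qed.

(** Induction by doubling: by symmetry [dot x (T^2n x)] is the squared norm of [T^n x], which by
    Cauchy-Schwarz is at least the square of [dot x (T^n x)]. *)
Lemma dot_iter_ge (x : I -> I -> R) m l : dot x x = 1 -> dot x (T x) = m -> 0 <= m ->
  m ^+ (2 ^ l) <= dot x (iter (2 ^ l) T x).
Proof.
move=> x1 xm m0; elim: l => [|l IH]; first by rewrite /= xm.
have sym n (y z : I -> I -> R) : dot (iter n T y) z = dot y (iter n T z).
  elim: n z => // n IHn z; rewrite iterS superop_sym IHn.
  by rewrite -iterSr.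
rewrite expnS mul2n -addnn iterD -sym exprD -expr2.
apply: (@le_trans _ _ (dot x (iter (2 ^ l) T x) ^+ 2)).
  by rewrite ler_pXn2r // nnegrE ?exprn_ge0 // (le_trans _ IH) ?exprn_ge0.
by apply: le_trans (dot_cauchy_schwarz _ _) _; rewrite x1 mul1r.
Qed.

(** Testing the domination on [x a b] times the coordinate vector of [a] and on that of [b] bounds
    each term of [dot x y], because the entries of [x] are at most 1 in modulus. *)
Lemma dominated_dot_le x (y : I -> I -> R) z : dot x x = 1 ->
  (forall v w, 2 * quad y v w <= quad z v v + quad z w w) ->
  gram z -> dot x y <= #|I|%:R * \sum_a z a a.
Proof.
move=> x1 H [J [u [_ uz]]].
have z0 a : 0 <= z a a by rewrite uz sumr_ge0 // => j _; rewrite -expr2 sqr_ge0.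
have quadE (t s : R) (y' : I -> I -> R) a b :
    quad y' (fun i => t * (i == a)%:R) (fun i => s * (i == b)%:R) = y' a b * t * s.
  rewrite /quad (bigD1 a) //= [X in _ + X]big1 => [|i ia]; last first.
    by rewrite big1 // => j _; rewrite (negbTE ia) !(mulr0, mul0r).
  rewrite (bigD1 b) //= [X in _ + X + _]big1 => [|i ib]; last first.
    by rewrite (negbTE ib) !(mulr0, mul0r).
  by rewrite !eqxx !mulr1 !addr0.
have x_le1 a b : x a b ^+ 2 <= 1.
  rewrite -x1 /dot (bigD1 a) //= (bigD1 b) //= -expr2 -addrA lerDl addr_ge0 //.
    by apply: sumr_ge0 => j _; rewrite -expr2 sqr_ge0.
  by apply: sumr_ge0 => i _; apply: sumr_ge0 => j _; rewrite -expr2 sqr_ge0.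
have E a b : 2 * (x a b * y a b) <= z a a + z b b.
  have := H (fun i => x a b * (i == a)%:R) (fun i => 1 * (i == b)%:R).
  by rewrite !quadE; have := x_le1 a b; have := z0 a; have := z0 b; nra.
have : 2 * dot x y <= \sum_a \sum_b (z a a + z b b).
  by rewrite /dot mulr_sumr; apply: ler_sum => a _; rewrite mulr_sumr; apply: ler_sum.
have -> : \sum_a \sum_b (z a a + z b b) = 2 * (#|I|%:R * \sum_a z a a).
  transitivity (\sum_a (#|I|%:R * z a a + \sum_b z b b)).
    by apply: eq_bigr => a _; rewrite big_split /= sumr_const mulr_natl.
  rewrite big_split /= -mulr_sumr sumr_const -[X in _ + X = _]mulr_natl.
  by rewrite [RHS]mulr_natl mulr2n.
by rewrite ler_pM2l.
Qed.

Lemma gram_trace_le z : (\sum_a z a a) ^+ 2 <= #|I|%:R * dot z z.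
Proof.
have := cauchy_schwarz_sum (fun=> 1) (fun a => z a a).
under eq_bigr do rewrite mul1r.
move=> /le_trans; apply.
under eq_bigr do rewrite expr1n.
rewrite sumr_const ler_wpM2l //; apply: ler_sum => a _.
by rewrite (bigD1 a) //= -expr2 lerDl sumr_ge0 // => b _; rewrite -expr2 sqr_ge0.
Qed.

Lemma bernoulli_le (h : R) n : 0 <= h -> 1 + n%:R * h <= (1 + h) ^+ n.
Proof.
move=> h0; elim: n => [|n IH]; first by rewrite mul0r addr0.
by rewrite exprS -natr1; have := ler0n R n; nra.
Qed.

(** By contradiction: otherwise the norms of the iterates of [centering] decay like [c ^- n], while
    they control [dot x (T^n x) >= m ^+ n] along powers of two. So [(c * m) ^+ n] would stay bounded
    although [c * m > 1]. *)
Lemma exists_gram_supercritical (x : I -> I -> R) (c : R) :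
  (forall a, \sum_b x a b = 0) -> (forall b, \sum_a x a b = 0) -> dot x x = 1 ->
  0 < c -> 1 < c * dot x (T x) ->
  exists2 z, gram z & dot z (T z) < c * dot (T z) (T z).
Proof.
move=> x0r x0c x1 c0 cm.
apply: contrapT => /forall2NP H.
have {}H z : gram z -> c * dot (T z) (T z) <= dot z (T z).
  by move=> gz; case: (H z) => // /negP; rewrite -leNgt.
(* Cauchy-Schwarz for [dot z (T z)] turns the negated claim into a contraction of norms by the
   factor [c^-1]. *)
have step z : gram z -> c ^+ 2 * dot (T z) (T z) <= dot z z.
  move=> gz; have h := H z gz; have N0 := dot_ge0 (T z); have M0 := dot_ge0 z.
  have CS := dot_cauchy_schwarz z (T z).
  have [N_eq0|N_neq0] := eqVneq (dot (T z) (T z)) 0; first by rewrite N_eq0 mulr0.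
  have Ngt0 : 0 < dot (T z) (T z) by rewrite lt_neqAle eq_sym N_neq0.
  rewrite -(ler_pM2r Ngt0); apply: le_trans CS.
  rewrite -mulrA -expr2 -exprMn ler_pXn2r // nnegrE ?(le_trans _ h) // mulr_ge0 // ltW //.
pose C n := iter n T centering.
have gC n : gram (C n) by elim: n => [|n]; [exact: gram_centering|exact: superop_gram].
have decay n : (c ^+ n) ^+ 2 * dot (C n) (C n) <= dot centering centering.
  elim: n => [|n IH]; first by rewrite expr0 expr1n mul1r.
  apply: le_trans IH; rewrite [c ^+ n.+1]exprS exprMn [c ^+ 2 * _]mulrC -mulrA.
  by rewrite ler_wpM2l ?sqr_ge0 // step.
have dom n : forall v w, 2 * quad (iter n T x) v w <= quad (C n) v v + quad (C n) w w.
  by elim: n => [|n IH]; [exact: unit_dominated|exact: superop_dominated].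
set m := dot x (T x) in cm.
have m0 : 0 < m by rewrite -(pmulr_rgt0 _ c0) (lt_trans ltr01).
pose q : R := #|I|%:R; pose K := q ^+ 3 * dot centering centering.
have bound l : (c * m) ^+ (2 ^ l) <= 1 + K.
  have a_ge := dot_iter_ge l x1 erefl (ltW m0); rewrite -/m in a_ge.
  have a_le := dominated_dot_le x1 (dom (2 ^ l)%N) (gC _).
  set n := (2 ^ l)%N in a_ge a_le *; set a := dot x _ in a_ge a_le.
  have mn0 : 0 <= m ^+ n by rewrite exprn_ge0 // ltW.
  have cn0 : 0 <= c ^+ n by rewrite exprn_ge0 // ltW.
  have tr := gram_trace_le (C n); set t := \sum_(i : I) _ in a_le tr.
  have q0 : 0 <= q by rewrite ler0n.
  have a0 : 0 <= a by exact: le_trans a_ge.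
  (* Combines [m ^+ n <= a <= q * t], the bound of [t ^+ 2] by [q] times the squared norm of [C n],
     and the decay; [K] does not depend on [l]. *)
  have h2 : (c ^+ n * m ^+ n) ^+ 2 <= K.
    apply: (@le_trans _ _ ((c ^+ n) ^+ 2 * (q * t) ^+ 2)).
      have qt0 : 0 <= q * t := le_trans a0 a_le.
      rewrite exprMn ler_wpM2l ?sqr_ge0 // ler_pXn2r ?nnegrE //.
      exact: le_trans a_le.
    apply: (@le_trans _ _ ((c ^+ n) ^+ 2 * (q ^+ 2 * (q * dot (C n) (C n))))).
      by rewrite ler_wpM2l ?sqr_ge0 // exprMn ler_wpM2l ?sqr_ge0.
    set N := dot (C n) (C n).
    have -> : (c ^+ n) ^+ 2 * (q ^+ 2 * (q * N)) = q ^+ 3 * ((c ^+ n) ^+ 2 * N) by ring.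
    by rewrite /K ler_wpM2l ?exprn_ge0 //; exact: decay.
  by rewrite exprMn; nra.
(* The right side is the Bernoulli lower bound for [(c * m) ^+ (2 ^ l)]; as [2 ^ l > l], the
   Archimedean bound serves as [l]. *)
have [l hl] : exists l : nat, 1 + K < 1 + (2 ^ l)%:R * (c * m - 1).
  have h0 : 0 < c * m - 1 by rewrite subr_gt0.
  exists (Num.bound (K / (c * m - 1))).
  rewrite ltrD2l -ltr_pdivrMr //.
  have [K0|K0] := leP 0 (K / (c * m - 1)).
    apply: lt_le_trans (archi_boundP K0) _.
    by rewrite ler_nat ltnW // ltn_expl.
  by apply: lt_le_trans K0 _; rewrite ler0n.
have cm1 : 0 <= c * m - 1 by rewrite subr_ge0 ltW.
have := le_trans (bernoulli_le (2 ^ l) cm1); rewrite [1 + (_ - _)]addrC subrK.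
by move=> /(_ _ (bound l)) /(lt_le_trans hl); rewrite ltxx.
Qed.

End PowerMethod.

Section Scaling.
Variables (R : realType) (I S : finType) (P : S -> R) (A : S -> I -> I -> R).
Implicit Types z : I -> I -> R.

Lemma dotZ (s t : R) z z' :
  dot (fun a b => s * z a b) (fun a b => t * z' a b) = s * t * dot z z'.
Proof.
rewrite /dot mulr_sumr; apply: eq_bigr => a _; rewrite mulr_sumr.
by apply: eq_bigr => b _; ring.
Qed.

Lemma superopZ (s : R) z :
  superop P A (fun a b => s * z a b) = (fun a b => s * superop P A z a b).
Proof.
apply/funext => a; apply/funext => b; rewrite /superop mulr_sumr.
apply: eq_bigr => c _; rewrite mulr_sumr; apply: eq_bigr => e _; ring.
Qed.

(** The product expands into the sum of the squared inner products of the factor vectors. *)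
Lemma dot_gram_ge0 z z' : gram z -> gram z' -> 0 <= dot z z'.
Proof.
move=> [J [u [_ uz]]] [J' [u' [_ uz']]].
suff -> : dot z z' = \sum_j \sum_l (\sum_a u j a * u' l a) ^+ 2.
  by apply: sumr_ge0 => j _; apply: sumr_ge0 => l _; exact: sqr_ge0.
transitivity (\sum_a \sum_b \sum_j \sum_l (u j a * u' l a) * (u j b * u' l b)).
  apply: eq_bigr => a _; apply: eq_bigr => b _; rewrite uz uz' mulr_suml.
  by apply: eq_bigr => j _; rewrite mulr_sumr; apply: eq_bigr => l _; ring.
under eq_bigr => a _ do rewrite exchange_big.
rewrite exchange_big; apply: eq_bigr => j _ /=.
under eq_bigr => a _ do rewrite exchange_big.
rewrite exchange_big; apply: eq_bigr => l _ /=.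
by rewrite expr2 mulr_suml; apply: eq_bigr => a _; rewrite mulr_sumr.
Qed.

End Scaling.

(** * Asymptotics of the entropy function *)

Section Entropy.
Variable R : realType.
Implicit Types (x y W : R).

(** [h] decreases to the left of 0 and increases to the right. Differentiability on a larger
    interval yields continuity up to the end points. *)
Lemma le_at0_of_derive (h h' : R -> R) :
  (forall x, `|x| < 1 -> is_derive x 1 h (h' x)) ->
  (forall x, `|x| < 1 / 2 -> 0 <= x * h' x) ->
  forall x, `|x| <= 1 / 2 -> h 0 <= h x.
Proof.
move=> dh h'0 x xle.
have small y : -(1/2) <= y -> y <= 1/2 -> `|y| < 1.
  by move=> y1 y2; rewrite ltr_norml; apply/andP; split; lra.
have D y : -(1/2) <= y -> y <= 1/2 -> derivable h y 1 /\ derive1 h y = h' y.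
  move=> y1 y2; have /[dup] dhy := dh y (small y y1 y2) => -[d <-]; split => //.
  by rewrite derive1E.
have C y : -(1/2) <= y -> y <= 1/2 -> {for y, continuous h}.
  by move=> y1 y2; apply/differentiable_continuous/derivable1_diffP; case: (D y y1 y2).
move: xle; rewrite ler_norml => /andP[x1 x2].
have [x0|x0] := leP 0 x.
- apply: (@ger0_derive1_ndecr _ h 0 (1/2)) => //.
  + by move=> y; rewrite in_itv /= => /andP[y1 y2]; apply: (D y _ _).1; lra.
  + move=> y; rewrite in_itv /= => /andP[y1 y2]; rewrite (D y _ _).2; [|lra|lra].
    by rewrite -(pmulr_rge0 _ y1) h'0 // ger0_norm // ltW.
  + apply: continuous_in_subspaceT => y; rewrite inE /= in_itv /= => /andP[y1 y2].
    by apply: C; lra.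
- apply: (@ler0_derive1_nincr _ h (-(1/2)) 0); rewrite ?(ltW x0) //.
  + by move=> y; rewrite in_itv /= => /andP[y1 y2]; apply: (D y _ _).1; lra.
  + move=> y; rewrite in_itv /= => /andP[y1 y2]; rewrite (D y _ _).2; [|lra|lra].
    have : 0 <= y * h' y by apply: h'0; rewrite ltr0_norm //; lra.
    by rewrite nmulr_rge0.
  + apply: continuous_in_subspaceT => y; rewrite inE /= in_itv /= => /andP[y1 y2].
    by apply: C; lra.
Qed.

Lemma is_derive_ln1Dx x : -1 < x -> is_derive x 1 (fun t : R => ln (1 + t)) (1 + x)^-1.
Proof.
move=> x1.
have -> : (1 + x)^-1 = (1 + x)^-1 *: (0 + 1) :> R by rewrite add0r /GRing.scale /= mulr1.
apply: is_derive1_comp; apply: is_derive1_ln; lra.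
Qed.

Lemma ln1Dx_le x : `|x| <= 1 / 2 -> ln (1 + x) <= x - x ^+ 2 / 2 + x ^+ 3 / 3.
Proof.
pose h t : R := t - t ^+ 2 / 2 + t ^+ 3 / 3 - ln (1 + t).
pose h' t : R := t ^+ 3 / (1 + t).
move=> xle; suff : h 0 <= h x.
  by rewrite /h addr0 ln1 !expr0n /= !mul0r !subr0 addr0 subr_ge0.
apply: (@le_at0_of_derive h h') => // {xle} {}x; rewrite ltr_norml => /andP[x1 x2].
  have dl := is_derive_ln1Dx x1.
  have e0 : 1 + x != 0 by rewrite gt_eqF //; lra.
  rewrite /h.
  apply: is_derive_eq; rewrite /h' /GRing.scale /=.
  by field.
rewrite /h' mulrA -exprS divr_ge0 //; last lra.
by rewrite (exprM x 2 2) sqr_ge0.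
Qed.

(** The coefficient 1 of [x ^+ 4], in place of the Taylor coefficient 1/4, gives the difference the
    derivative [x ^+ 3 * (3 + 4 * x) / (1 + x)], which has the sign of [x] for [|x| < 1 / 2]. *)
Lemma ln1Dx_ge x : `|x| <= 1 / 2 ->
  x - x ^+ 2 / 2 + x ^+ 3 / 3 - x ^+ 4 <= ln (1 + x).
Proof.
pose h t : R := ln (1 + t) - (t - t ^+ 2 / 2 + t ^+ 3 / 3 - t ^+ 4).
pose h' t : R := t ^+ 3 * (3 + 4 * t) / (1 + t).
move=> xle; suff : h 0 <= h x.
  by rewrite /h addr0 ln1 !expr0n /= !mul0r !subr0 addr0 subr0 subr_ge0.
apply: (@le_at0_of_derive h h') => // {xle} {}x; rewrite ltr_norml => /andP[x1 x2].
  have dl := is_derive_ln1Dx x1.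
  have e0 : 1 + x != 0 by rewrite gt_eqF //; lra.
  rewrite /h.
  apply: is_derive_eq; rewrite /h' /GRing.scale /=.
  by field.
have -> : x * h' x = x ^+ 4 * (3 + 4 * x) / (1 + x) by rewrite /h'; ring.
rewrite divr_ge0 //; last lra.
by rewrite mulr_ge0 ?(exprM x 2 2) ?sqr_ge0 //; lra.
Qed.

Lemma LambdaE y : 0 < y -> Lambda y = y * ln y.
Proof. by move=> y0; rewrite /Lambda gt_eqF. Qed.

(** Multiply the bounds on [ln (1 + W)] by [1 + W]: the error starts with [- W ^+ 3 / 6], and the
    higher powers are absorbed for [|W| <= 1 / 2]. *)
Lemma Lambda_approx W : `|W| <= 1 / 2 ->
  `|Lambda (1 + W) - (W + W ^+ 2 / 2)| <= `|W| ^+ 3.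
Proof.
move=> Wle; have := ln1Dx_le Wle; have := ln1Dx_ge Wle.
move: Wle; rewrite ler_norml => /andP[W1 W2] lo hi.
have p : 0 < 1 + W by lra.
rewrite LambdaE //.
have {}lo := ler_wpM2l (ltW p) lo; have {}hi := ler_wpM2l (ltW p) hi.
set L := (1 + W) * ln _ in lo hi *.
rewrite ler_norml.
have [W0|W0] := leP 0 W.
  rewrite ger0_norm //; have W3 : 0 <= W ^+ 3 by rewrite exprn_ge0.
  have W4 : W ^+ 4 <= W ^+ 3 / 2 by rewrite exprSr ler_wpM2l //; lra.
  have W40 : 0 <= W ^+ 4 by rewrite exprn_ge0.
  have W5 : W ^+ 5 <= W ^+ 4 / 2 by rewrite exprSr ler_wpM2l //; lra.
  have W50 : 0 <= W ^+ 5 by rewrite exprn_ge0.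
  by apply/andP; split; lra.
rewrite ltr0_norm //; set V := - W; have V0 : 0 <= V by rewrite /V; lra.
have WV : W = - V by rewrite opprK.
have V3 : 0 <= V ^+ 3 by rewrite exprn_ge0.
have V4 : V ^+ 4 <= V ^+ 3 / 2 by rewrite exprSr ler_wpM2l //; rewrite /V; lra.
have V40 : 0 <= V ^+ 4 by rewrite exprn_ge0.
have V5 : V ^+ 5 <= V ^+ 4 / 2 by rewrite exprSr ler_wpM2l //; rewrite /V; lra.
have V50 : 0 <= V ^+ 5 by rewrite exprn_ge0.
by rewrite WV in lo hi *; clearbody L V; apply/andP; split; lra.
Qed.

(** The tangent at 1 of a convex function; it makes the mean of [Lambda] over a variable of mean 1
    nonnegative. *)
Lemma Lambda_ge y : 0 <= y -> y - 1 <= Lambda y.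
Proof.
rewrite le_eqVlt => /predU1P[<-|y0]; first by rewrite /Lambda eqxx; lra.
rewrite LambdaE //.
have := @le_ln1Dx R (y^-1 - 1); rewrite [1 + _]addrC subrK lnV ?posrE //.
have y0' : 0 < y^-1 by rewrite invr_gt0.
move=> /(_ ltac:(lra)) h.
have := ler_wpM2l (ltW y0) h; rewrite mulrBr divff ?gt_eqF //; lra.
Qed.

(** From [ln y <= y - 1]; it bounds an entropy by a second moment, which factorizes over independent
    constraints. *)
Lemma Lambda_le y : 0 <= y -> Lambda y <= y ^+ 2 - y.
Proof.
rewrite le_eqVlt => /predU1P[<-|y0]; first by rewrite /Lambda eqxx expr0n subrr.
rewrite LambdaE // expr2 -[X in _ - X]mulr1 -mulrBr ler_wpM2l ?(ltW y0) //.
by have := @le_ln1Dx R (y - 1); rewrite [1 + _]addrC subrK; apply; lra.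
Qed.

Lemma LambdaM x y : 0 < x -> 0 <= y -> Lambda (x * y) = x * Lambda y + x * y * ln x.
Proof.
move=> x0; rewrite le_eqVlt => /predU1P[<-|y0].
  by rewrite mulr0 /Lambda eqxx mulr0 mul0r addr0.
by rewrite !LambdaE ?mulr_gt0 // lnM ?posrE //; ring.
Qed.

End Entropy.

(** * Orders of vanishing at 0 from the right *)

Section BigO.
Variable R : realType.
Implicit Types (f : R -> R) (n : nat).

Definition bigO0 n f : Prop :=
  exists K, \forall e \near (0 : R)^'+, `|f e| <= K * e ^+ n.

Lemma bigO0_add n f1 f2 : bigO0 n f1 -> bigO0 n f2 -> bigO0 n (fun e => f1 e + f2 e).
Proof.
move=> [K1 H1] [K2 H2]; exists (K1 + K2); near=> e.
rewrite (le_trans (ler_normD _ _)) // mulrDl lerD //.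
  by near: e.
by near: e.
Unshelve. all: by end_near. Qed.

Lemma bigO0_scale n (c : R) f : bigO0 n f -> bigO0 n (fun e => c * f e).
Proof.
move=> [K H]; exists (`|c| * K); near=> e.
by rewrite normrM -mulrA ler_wpM2l //; near: e.
Unshelve. all: by end_near. Qed.

Lemma bigO0_sum n (J : Type) (r : seq J) (F : J -> R -> R) :
  (forall j, bigO0 n (F j)) -> bigO0 n (fun e => \sum_(j <- r) F j e).
Proof.
move=> H; elim: r => [|j r IH].
  by exists 0; near=> e; rewrite big_nil normr0 mul0r.
have [K HK] := bigO0_add (H j) IH; exists K; near=> e.
by rewrite big_cons; near: e.
Unshelve. all: by end_near. Qed.

Lemma bigO0_eq n f1 f2 : (\forall e \near (0 : R)^'+, f1 e = f2 e) ->
  bigO0 n f1 -> bigO0 n f2.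
Proof.
move=> E [K H]; exists K; near=> e.
by rewrite -(near E e) //; near: e.
Unshelve. all: by end_near. Qed.

Lemma bigO0_horner n (p : {poly R}) : (forall i, (i < n)%N -> p`_i = 0) ->
  bigO0 n (fun e => p.[e]).
Proof.
move=> p0; exists (\sum_(i < size p) `|p`_i|); near=> e.
have e0 : 0 <= e by near: e; exact: nbhs_right_ge.
have e1 : e <= 1 by near: e; apply: nbhs_right_le.
rewrite horner_coef (le_trans (ler_norm_sum _ _ _)) // mulr_suml.
apply: ler_sum => i _; rewrite normrM (ger0_norm (exprn_ge0 _ e0)).
have [/p0 ->|ni] := ltnP i n; first by rewrite normr0 !mul0r.
by rewrite ler_wpM2l // ler_wiXn2l.
Unshelve. all: by end_near. Qed.

(** The quadratic approximation errs by at most [|W| ^+ 3], of order six. It applies once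
    [|W| <= 1 / 2], hence the smallness of [e] in terms of [K]. *)
Lemma bigO0_Lambda W : bigO0 2 W ->
  bigO0 6 (fun e => Lambda (1 + W e) - (W e + W e ^+ 2 / 2)).
Proof.
move=> [K H]; exists (`|K| ^+ 3); near=> e.
have e0 : 0 <= e by near: e; exact: nbhs_right_ge.
have He : `|W e| <= `|K| * e ^+ 2.
  apply: (@le_trans _ _ (K * e ^+ 2)); first by near: e.
  by rewrite ler_wpM2r ?exprn_ge0 // ler_norm.
have e1 : e <= 1 by near: e; apply: nbhs_right_le.
have eK : e * (2 * `|K| + 1) <= 1.
  rewrite -ler_pdivlMr ?ltr_pwDr // ?mulr_ge0 //.
  by near: e; apply: nbhs_right_le; rewrite divr_gt0 // ltr_pwDr // mulr_ge0.
have W2 : `|W e| <= 1 / 2.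
  apply: le_trans He _; have := normr_ge0 K; nra.
apply: le_trans (Lambda_approx W2) _.
have -> : `|K| ^+ 3 * e ^+ 6 = (`|K| * e ^+ 2) ^+ 3 by ring.
by rewrite ler_pXn2r ?nnegrE ?mulr_ge0 ?exprn_ge0.
Unshelve. all: by end_near. Qed.

Lemma bigO0_pos f (a : R) : 0 < a -> bigO0 6 (fun e => f e - a * e ^+ 4) ->
  \forall e \near (0 : R)^'+, 0 < f e.
Proof.
move=> a0 [K H]; near=> e.
have e0 : 0 < e by near: e; exact: nbhs_right_gt.
have e1 : e <= 1 by near: e; apply: nbhs_right_le.
have : `|f e - a * e ^+ 4| <= K * e ^+ 6 by near: e.
have Ka : e * (`|K| + 1) < a.
  rewrite -ltr_pdivlMr ?ltr_pwDr //.
  by near: e; apply: nbhs_right_lt; rewrite divr_gt0 // ltr_pwDr.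
rewrite ler_norml => /andP[lo _].
have e4 : 0 < e ^+ 4 by rewrite exprn_gt0.
have : K * e ^+ 2 < a.
  by have := ler_norm K; have := normr_ge0 K; nra.
have -> : f e = f e - a * e ^+ 4 + a * e ^+ 4 by rewrite subrK.
rewrite -(ltr_pM2r e4) -mulrA -exprD; lra.
Unshelve. all: by end_near. Qed.

End BigO.

(** * Poisson series *)

Section Poisson.
Variables (R : realType) (d : R).
Hypothesis d_gt0 : 0 < d.

Lemma poissonW_ge0 g : 0 <= poissonW d g.
Proof. by rewrite /poissonW !mulr_ge0 ?invr_ge0 ?expR_ge0 ?exprn_ge0 // ltW. Qed.

Lemma cvg_series_scale (c : R) (u : nat -> R) (l : R) :
  series u @ \oo --> l -> series (fun n => c * u n) @ \oo --> c * l.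
Proof.
move=> ul; rewrite (_ : series _ = (fun n => c * series u n)); first exact: cvgMr.
by apply/funext => n; rewrite /series /= mulr_sumr.
Qed.

Lemma cvg_series_add (u v : nat -> R) (a b : R) :
  series u @ \oo --> a -> series v @ \oo --> b ->
  series (fun n => u n + v n) @ \oo --> a + b.
Proof.
move=> ua vb; rewrite (_ : series _ = (fun n => series u n + series v n)); first exact: cvgD.
by apply/funext => n; rewrite /series /= big_split.
Qed.

Lemma cvg_series_shift (u : nat -> R) (l : R) : u 0%N = 0 ->
  series (fun n => u n.+1) @ \oo --> l -> series u @ \oo --> l.
Proof.
move=> u0 ul; rewrite -cvg_shiftS.
rewrite (_ : (fun _ => _) = series (fun n => u n.+1)) //.
by apply/funext => n; rewrite /series /= big_nat_recl // u0 add0r.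
Qed.

Lemma cvg_series_poissonX (M : R) :
  series (fun g => poissonW d g * M ^+ g) @ \oo --> expR (- d) * expR (d * M).
Proof.
rewrite (_ : (fun _ => _) = (fun g => expR (- d) * exp_coeff (d * M) g)).
  by apply: cvg_series_scale; exact: is_cvg_series_exp_coeff.
by apply/funext => g; rewrite /poissonW /exp_coeff /= exprMn; ring.
Qed.

Lemma cvg_series_poissonW : series (poissonW d) @ \oo --> (1 : R).
Proof.
have := @cvg_series_poissonX 1; rewrite mulr1 -expRD addNr expR0.
by under eq_fun do rewrite expr1n mulr1.
Qed.

(** The size-biasing identity; with an index shift it yields the factorial moments. *)
Lemma poissonWS g : poissonW d g.+1 * g.+1%:R = d * poissonW d g.
Proof.
rewrite /poissonW factS natrM exprS.
by field; rewrite pnatr_eq0 -lt0n fact_gt0 nat1r pnatr_eq0.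
Qed.

Lemma cvg_series_poisson_mean : series (fun g => poissonW d g * g%:R) @ \oo --> d.
Proof.
apply: cvg_series_shift; first by rewrite mulr0.
under eq_fun do rewrite poissonWS.
by have := @cvg_series_scale d _ _ cvg_series_poissonW; rewrite mulr1.
Qed.

Lemma cvg_series_poisson_fact2 :
  series (fun g => poissonW d g * (g%:R * (g%:R - 1))) @ \oo --> d ^+ 2.
Proof.
apply: cvg_series_shift; first by rewrite mul0r mulr0.
under eq_fun do rewrite mulrA poissonWS -natr1 addrK -mulrA.
by apply: cvg_series_scale; exact: cvg_series_poisson_mean.
Qed.

(** The full series sums to [d * a + d ^+ 2 * b] by the factorial moments, and a strict inequality
    for the limit already holds for a partial sum. *)
Lemma exists_poisson_truncation (a b t : R) : t < d * a + d ^+ 2 * b ->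
  exists G, t < \sum_(g < G) poissonW d g * (g%:R * a + g%:R * (g%:R - 1) * b).
Proof.
move=> tlt.
have : series (fun g => poissonW d g * (g%:R * a + g%:R * (g%:R - 1) * b)) @ \oo
    --> d * a + d ^+ 2 * b.
  under eq_fun do rewrite mulrDr mulrA [X in _ + X]mulrA mulrC [X in _ + X]mulrC.
  rewrite [d * a]mulrC [d ^+ 2 * b]mulrC.
  apply: cvg_series_add; apply: cvg_series_scale.
    exact: cvg_series_poisson_mean.
  exact: cvg_series_poisson_fact2.
move=> /cvgr_gt /(_ _ tlt) [G _ /(_ G (leqnn G))] /= h.
by exists G; move: h; rewrite /series /= big_mkord.
Qed.

(** As [b] is nonnegative, dropping its tail only decreases the sum. The geometric bound guarantees
    convergence, so that [limn] is a genuine limit. *)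
Lemma poisson_limn_ge (b : nat -> R) (a c M : R) (G : nat) :
  (forall g, 0 <= b g <= M ^+ g) ->
  d * a + c + \sum_(g < G) poissonW d g * b g <=
  limn (series (fun g => poissonW d g * (g%:R * a + c + b g))).
Proof.
move=> bM.
have pb0 g : 0 <= poissonW d g * b g.
  by rewrite mulr_ge0 ?poissonW_ge0 //; case/andP: (bM g).
have cb : cvgn (series (fun g => poissonW d g * b g)).
  apply: (@series_le_cvg _ _ (fun g => poissonW d g * M ^+ g)) => //.
  - move=> g; rewrite mulr_ge0 ?poissonW_ge0 //; case/andP: (bM g); exact: le_trans.
  - by move=> g; rewrite ler_wpM2l ?poissonW_ge0 //; case/andP: (bM g).
  - by apply/cvg_ex; eexists; exact: cvg_series_poissonX.
set l := limn (series (fun g => poissonW d g * b g)).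
have -> : limn (series (fun g => poissonW d g * (g%:R * a + c + b g))) = d * a + c + l.
  apply/cvg_lim => //.
  under eq_fun do rewrite !mulrDr.
  apply: cvg_series_add => //; apply: cvg_series_add.
    rewrite mulrC; under eq_fun do rewrite mulrA mulrC.
    by apply: cvg_series_scale; exact: cvg_series_poisson_mean.
  have := @cvg_series_scale c _ _ cvg_series_poissonW; rewrite mulr1.
  by under [X in series X]eq_fun do rewrite mulrC.
rewrite lerD2l -(big_mkord xpredT (fun g => poissonW d g * b g)).
apply: (@nondecreasing_cvgn_le _ (series (fun g => poissonW d g * b g))) => //.
exact: (@nondecreasing_series _ _ xpredT).
Qed.

End Poisson.

(** * Finitely supported samples *)

Section UniformLaw.
Variables (R : realType) (n : nat).

Let w : {nonneg R} := (n.+1%:R^-1)%:nng.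

(** On [nat], where all sets are measurable, every function of the sample is measurable. *)
Definition uniform_nat : set nat -> \bar R :=
  msum (fun k => mscale w (\d_k : {measure set nat -> \bar R})) n.+1.

HB.instance Definition _ := Measure.on uniform_nat.

Lemma uniform_nat_setT : uniform_nat setT = 1%E.
Proof.
rewrite /uniform_nat /msum /= /mscale /=.
under eq_bigr do rewrite diracT mule1.
rewrite sumEFin sumr_const card_ord -[_ *+ _]mulr_natr mulVf //.
Qed.

HB.instance Definition _ := Measure_isProbability.Build _ _ R uniform_nat uniform_nat_setT.

Lemma ge0_integral_uniform_nat (f : nat -> \bar R) : (forall x, 0 <= f x)%E ->
  (\int[uniform_nat]_x f x = \sum_(k < n.+1) (n.+1%:R^-1)%:E * f k)%E.
Proof.
move=> f0; rewrite /uniform_nat ge0_integral_measure_sum //.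
apply: eq_bigr => k _; rewrite ge0_integral_mscale // integral_dirac // diracT.
by rewrite mul1e.
Qed.

Lemma Rintegral_uniform_nat (f : nat -> R) :
  Rintegral uniform_nat setT f = n.+1%:R^-1 * \sum_(k < n.+1) f k.
Proof.
rewrite /Rintegral integralE !ge0_integral_uniform_nat //.
under eq_bigr do rewrite funeposE -EFin_max -EFinM.
under [X in (_ - X)%E]eq_bigr do rewrite funenegE -EFinN -EFin_max -EFinM.
rewrite !sumEFin -EFinB /= mulr_sumr -sumrB; apply: eq_bigr => k _.
rewrite -mulrBr; congr (_ * _).
by case: (leP (f k) 0); case: (leP (- f k) 0); lra.
Qed.

End UniformLaw.

(** * Independent samples as iterated averages *)

Section IidSample.
Variables (R : realType) (I : finType).

(** An enumeration of [I] carries the uniform law on an initial segment of [nat] to [I]; [i0] is the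
    default of [nth] and shows that [I] is nonempty. *)
Lemma exists_uniform_law (i0 : I) : exists (mu : probability nat R) (X : nat -> I),
  forall f : I -> R, Rintegral mu setT (f \o X) = #|I|%:R^-1 * \sum_i f i.
Proof.
have I0 : (0 < #|I|)%N by apply/card_gt0P; exists i0.
exists (uniform_nat R #|I|.-1), (fun n => nth i0 (enum I) n) => f.
rewrite Rintegral_uniform_nat prednK //; congr (_ * _).
by rewrite -(big_mkord xpredT (fun k => f (nth i0 (enum I) k))) cardE
  -(big_nth i0 xpredT f) big_enum.
Qed.

Definition avg (f : I -> R) : R := #|I|%:R^-1 * \sum_i f i.

Fixpoint iid_avg n (f : seq I -> R) : R :=
  if n is n'.+1 then avg (fun i => iid_avg n' (fun s => f (i :: s))) else f [::].

Lemma eq_avg f g : f =1 g -> avg f = avg g.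
Proof. by move=> fg; congr (_ * _); apply: eq_bigr => i _. Qed.

Lemma iid_avgD m n f :
  iid_avg (m + n) f = iid_avg m (fun s => iid_avg n (fun t => f (s ++ t))).
Proof.
elim: m f => [|m IH] f //=.
by apply: eq_avg => i; rewrite IH.
Qed.

Lemma iid_avg_ffun n (f : seq I -> R) :
  iid_avg n f = #|I|%:R ^- n * \sum_(s : {ffun 'I_n -> I}) f (codom s).
Proof.
elim: n f => [|n IH] f.
  rewrite expr0 invr1 mul1r (big_pred1 (ffun0 (card_ord 0))) //=.
    by rewrite /codom /image_mem (size0nil (s := enum _)) // size_enum_ord.
  by move=> s; apply/esym/eqP/ffunP => -[].
rewrite [LHS]/= /avg; under [in LHS]eq_bigr => i _ do rewrite IH.
rewrite -mulr_sumr mulrA -invfM -exprS; congr (_ * _).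
pose cons_ffun (p : I * {ffun 'I_n -> I}) : {ffun 'I_n.+1 -> I} :=
  [ffun j => if unlift ord0 j is Some j' then p.2 j' else p.1].
pose split_ffun (s : {ffun 'I_n.+1 -> I}) := (s ord0, [ffun j => s (lift ord0 j)]).
rewrite pair_bigA /= (reindex cons_ffun) /=; last first.
  exists split_ffun => [[i s] _|s _].
    rewrite /split_ffun /cons_ffun ffunE unlift_none /=; congr pair.
    by apply/ffunP => j; rewrite !ffunE liftK.
  apply/ffunP => j; rewrite !ffunE /=.
  by case: unliftP => [j'|] -> //=; rewrite ffunE.
apply: eq_bigr => -[i s] _ /=; congr f.
rewrite /codom /image_mem enum_ordSl /= ffunE unlift_none; congr (_ :: _).
by rewrite -map_comp; apply: eq_map => j; rewrite /= ffunE liftK.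
Qed.

End IidSample.

Section BlockSample.
Variables (R : realType) (I : finType) (m : nat).

(** The flat list of samples is cut into one block of length [m] per constraint; entry [j] of block
    [i] sits at [i * m + j], the indexing of [Zfirst]. *)
Lemma iid_avg_block g (f : seq I -> R) :
  iid_avg (g * m) f =
  iid_avg g (fun S : seq {ffun 'I_m -> I} => f (flatten [seq codom (fun_of_fin s) | s <- S])).
Proof.
elim: g f => [|g IH] f //.
rewrite mulSn iid_avgD iid_avg_ffun [RHS]/= /avg card_ffun card_ord natrX.
by congr (_ * _); apply: eq_bigr => s _; rewrite IH.
Qed.

Lemma nth_flatten_codom (V : Type) (v0 : V) (r : I -> V) g
    (S : {ffun 'I_g -> {ffun 'I_m -> I}}) (i : 'I_g) (j : 'I_m) :
  nth v0 [seq r t | t <- flatten [seq codom (fun_of_fin s) | s <- codom S]] (i * m + j) = r (S i j).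
Proof.
have szE (s : {ffun 'I_m -> I}) : size (codom s) = m by rewrite size_codom card_ord.
have aux (L : seq {ffun 'I_m -> I}) s0 n : (n < size L)%N ->
    nth v0 [seq r t | t <- flatten [seq codom (fun_of_fin s) | s <- L]] (n * m + j) =
      r (nth s0 L n j).
  elim: L n => [|s L IHL] [|n] //= nL; rewrite map_cat nth_cat size_map szE.
    rewrite mul0n add0n ltn_ord.
    by rewrite -map_comp (nth_map j) ?size_enum_ord ?nth_ord_enum.
  by rewrite mulSn -addnA ltnNge leq_addr /= addKn IHL.
have i_lt : (i < size (codom S))%N by rewrite size_codom card_ord.
by rewrite (aux _ (S i)) // (nth_map i) ?size_enum_ord // nth_ord_enum.
Qed.

End BlockSample.

Section Averages.
Variables (R : realType) (J : finType).
Implicit Types f g : J -> R.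

Lemma avgD f g : avg (fun i => f i + g i) = avg f + avg g.
Proof. by rewrite /avg big_split mulrDr. Qed.

Lemma avgZ (c : R) f : avg (fun i => c * f i) = c * avg f.
Proof. by rewrite /avg -mulr_sumr mulrCA. Qed.

Lemma avg_sum (K : Type) (r : seq K) (Q : pred K) (F : K -> J -> R) :
  avg (fun i => \sum_(k <- r | Q k) F k i) = \sum_(k <- r | Q k) avg (F k).
Proof. by rewrite /avg exchange_big mulr_sumr. Qed.

Lemma avg_cst (c : R) : (0 < #|J|)%N -> avg (fun _ : J => c) = c.
Proof.
move=> J0; rewrite /avg sumr_const -[c *+ _]mulr_natl mulrA mulVf ?mul1r //.
by rewrite pnatr_eq0 -lt0n.
Qed.

Lemma ler_avg f g : (forall i, f i <= g i) -> avg f <= avg g.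
Proof. by move=> fg; rewrite ler_wpM2l ?invr_ge0 //; apply: ler_sum. Qed.

End Averages.

Lemma avg_prod (R : realType) (J : finType) n (h : 'I_n -> J -> R) :
  avg (fun s : {ffun 'I_n -> J} => \prod_j h j (s j)) = \prod_j avg (h j).
Proof.
rewrite /avg big_split /= prodr_const card_ord card_ffun card_ord natrX exprVn.
by rewrite bigA_distr_bigA.
Qed.

Lemma iid_avgE (R : realType) (J : finType) n (f : seq J -> R) :
  iid_avg n f = avg (fun s : {ffun 'I_n -> J} => f (codom s)).
Proof. by rewrite iid_avg_ffun /avg card_ffun card_ord natrX. Qed.

(** * Moments of the constraint kernels *)

Section Coefficients.
Variable R : comNzRingType.
Implicit Types p q : {poly R}.

Lemma coef1M p q : (p * q)`_1 = p`_0 * q`_1 + p`_1 * q`_0.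
Proof. by rewrite coefM !big_ord_recl big_ord0 addr0. Qed.

Lemma coef2M p q : (p * q)`_2 = p`_0 * q`_2 + p`_1 * q`_1 + p`_2 * q`_0.
Proof. by rewrite coefM !big_ord_recl big_ord0 addr0 addrA. Qed.

Lemma coef0_prod (J : finType) (F : J -> {poly R}) :
  (forall j, (F j)`_0 = 1) -> (\prod_j F j)`_0 = 1.
Proof.
by move=> F0; elim/big_rec: _ => [|j p _ IH]; rewrite ?coef1 // coef0M F0 IH mul1r.
Qed.

Lemma coef1_prod (J : finType) (F : J -> {poly R}) :
  (forall j, (F j)`_0 = 1) -> (\prod_j F j)`_1 = \sum_j (F j)`_1.
Proof.
move=> F0.
suff [] : (\prod_j F j)`_0 = 1 /\ (\prod_j F j)`_1 = \sum_j (F j)`_1 by [].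
elim/big_ind2: _ => [|a b p q [p0 p1] [q0 q1]|j _] //; first by rewrite !coef1.
by rewrite coef0M coef1M p0 q0 p1 q1 !mul1r mulr1 addrC.
Qed.

(** The split into multiples of [g] and [g (g - 1)] matches the factorial moments of the Poisson
    law. *)
Lemma coef_exp2 p g : p`_0 = 1 ->
  [/\ (p ^+ g)`_0 = 1, (p ^+ g)`_1 = g%:R * p`_1 &
      (p ^+ g)`_2 *+ 2 = g%:R * (p`_2 *+ 2) + g%:R * (g%:R - 1) * p`_1 ^+ 2].
Proof.
move=> p0; elim: g => [|g [IH0 IH1 IH2]]; first by rewrite expr0 !coef1 !mul0r !addr0 mul0rn.
rewrite exprS coef0M coef1M coef2M p0 IH0 IH1 !mul1r !mulr1; split=> //.
  by rewrite -natr1; ring.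
by rewrite !mulrnDl IH2 -natr1; ring.
Qed.

(* Coefficient 2 is doubled because [R] need not admit division by 2. *)
Lemma coef_prod1DX n (c : 'I_n -> R) (p := \prod_j (1 + c j *: 'X)) :
  [/\ p`_0 = 1, p`_1 = \sum_j c j &
      p`_2 *+ 2 = \sum_j \sum_(l | l != j) c j * c l].
Proof.
(* The square minus the diagonal is a form that an induction over the product can follow. *)
have E : \sum_j \sum_(l | l != j) c j * c l = (\sum_j c j) ^+ 2 - \sum_j c j ^+ 2.
  rewrite expr2 mulr_suml -sumrB; apply: eq_bigr => j _.
  by rewrite mulr_sumr [in RHS](bigD1 j) //= expr2 addrAC subrr add0r.
rewrite E {E} /p; elim/big_ind3: _ => [|a y q b z r [p0 p1 p2] [q0 q1 q2]|j _].
- by rewrite !coef1 mul0rn expr0n subrr.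
- rewrite coef0M coef1M coef2M p0 q0 p1 q1 !mul1r !mulr1 addrC; split=> //.
  by rewrite !mulrnDl p2 q2; ring.
- by rewrite !coefD !coef1 !coefZ !coefX /= !mulr0 mulr1 !addr0 add0r mul0rn subrr.
Qed.

End Coefficients.

(** * Marginals and covariances of the normalized constraints *)

Section Kernel.
Variables (R : realType) (Omega : finType) (m : nat) (Psi : finType).
Local Notation k := m.+2.
Local Notation tup := {ffun 'I_k -> Omega}.
Variables (psi : Psi -> tup -> R) (P : Psi -> R).
Hypothesis psiP : standing psi P.
Hypothesis symP : SYM psi P.

Local Notation q := (#|Omega|%:R : R).

Let psi_inj : injective psi. Proof. by case: psiP => _ []. Qed.
Let psi01 p s : 0 <= psi p s <= 1. Proof. by case: psiP => _ [_ []]. Qed.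
Let P_gt0 p : 0 < P p. Proof. by case: psiP => _ [_ [_ [_ []]]]. Qed.
Let P_sum : \sum_p P p = 1. Proof. by case: psiP => _ [_ [_ [_ [_ []]]]]. Qed.

Lemma card_Omega_gt0 : (0 < #|Omega|)%N.
Proof.
case: psiP => _ [_ [_ [_ [_ [_ [p [s _]]]]]]].
by apply/card_gt0P; exists (s ord0).
Qed.

Lemma card_Omega_neq0 : q != 0.
Proof. by rewrite pnatr_eq0 -lt0n card_Omega_gt0. Qed.

Lemma xi_gt0 : 0 < xi psi P.
Proof.
case: psiP => _ [_ [_ [_ [_ [_ [p [s [p' [s' lt_pp']]]]]]]]].
have h0 s1 p1 : 0 <= P p1 * psi p1 s1.
  by rewrite mulr_ge0 ?(ltW (P_gt0 _)) //; case/andP: (psi01 p1 s1).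
rewrite /xi mulr_gt0 ?invr_gt0 ?exprn_gt0 ?ltr0n ?card_Omega_gt0 //.
rewrite (bigD1 s') //= ltr_wpDr ?sumr_ge0 // => [s1 _|]; first exact: sumr_ge0.
rewrite (bigD1 p') //= ltr_wpDr ?sumr_ge0 // mulr_gt0 //.
by apply: le_lt_trans lt_pp'; case/andP: (psi01 p s).
Qed.

(** Normalized such that, by SYM, each coordinate has the counting measure on [Omega] as its
    marginal. *)
Definition kap (p : Psi) (tau : tup) : R := psi p tau / (q ^+ m.+1 * xi psi P).

Let den_neq0 : q ^+ m.+1 * xi psi P != 0.
Proof. by rewrite mulf_neq0 ?expf_neq0 ?card_Omega_neq0 // gt_eqF ?xi_gt0. Qed.

Lemma kap_ge0 p tau : 0 <= kap p tau.
Proof.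
rewrite /kap divr_ge0 //; first by case/andP: (psi01 p tau).
by rewrite mulr_ge0 ?exprn_ge0 ?ler0n // ltW ?xi_gt0.
Qed.

Lemma sum_kap_marginal i w p : \sum_(tau : tup | tau i == w) kap p tau = 1.
Proof. by rewrite /kap -mulr_suml symP.1 divff. Qed.

Lemma sum_kap_fun i p (h : Omega -> R) : \sum_tau kap p tau * h (tau i) = \sum_w h w.
Proof.
rewrite (partition_big (fun tau : tup => tau i) predT) //=.
apply: eq_bigr => w _; rewrite -[RHS]mul1r -(sum_kap_marginal i w p) mulr_suml.
by apply: eq_bigr => tau /eqP ->.
Qed.

Lemma sum_kap p : \sum_tau kap p tau = q.
Proof.
under eq_bigr do rewrite -[kap _ _]mulr1.
by rewrite (sum_kap_fun ord0 p (fun=> 1)) sumr_const.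
Qed.

Let ord1 : 'I_k := lift ord0 ord0.

Lemma PhiE p a c :
  Phi psi P p a c = \sum_(tau : tup | (tau ord0 == a) && (tau ord1 == c)) kap p tau.
Proof.
have idE (i : 'I_k) (tau : tup) w : coordIs tau i w = (tau i == w).
  apply/existsP/idP => [[j /andP[/eqP /val_inj -> //]]|tw].
  by exists i; rewrite eqxx.
rewrite /Phi -mulr_suml [LHS]mulrC [in RHS]invfM; congr (_ * _).
by apply: eq_bigl => tau; rewrite -(idE ord0) -(idE ord1).
Qed.

Lemma sum_Phi p c : \sum_a Phi psi P p a c = 1.
Proof.
under eq_bigr do rewrite PhiE.
rewrite -(sum_kap_marginal ord1 c p).
rewrite [RHS](partition_big (fun tau : tup => tau ord0) predT) //=.
by apply: eq_bigr => a _; apply: eq_bigl => tau; rewrite andbC.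
Qed.

Lemma exists_perm_two (i j : 'I_k) : i != j ->
  exists theta : {perm 'I_k}, theta ord0 = i /\ theta ord1 = j.
Proof.
move=> ij; pose j' := tperm ord0 i j.
have j'0 : j' != ord0.
  by rewrite -(inj_eq (@perm_inj _ (tperm ord0 i))) /j' tpermK tpermL eq_sym.
exists (tperm ord1 j' * tperm ord0 i)%g; rewrite !permM; split; last by rewrite tpermL /j' tpermK.
by rewrite [tperm ord1 j' _]tpermD ?tpermL // eq_sym.
Qed.

(** Permuting coordinates acts on [Psi] by a map [f], injective because [psi] is, hence bijective;
    by SYM it preserves [P]. *)
Lemma sum_kap_perm (theta : {perm 'I_k}) (F : (tup -> R) -> R) :
  \sum_p P p * F (fun tau => kap p (permTup theta tau)) = \sum_p P p * F (kap p).
Proof.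
have clos p : exists p', forall tau, psi p' tau = psi p (permTup theta tau).
  by case: psiP => _ [_ [_ []]].
have [f fE] := choice clos.
have f_inj : injective f.
  move=> p1 p2 f12; apply: psi_inj; apply/funext => tau.
  have -> : tau = permTup theta (permTup theta^-1%g tau).
    by apply/ffunP => i; rewrite !ffunE permK.
  by rewrite -!fE f12.
rewrite [RHS](reindex_inj f_inj) /=; apply: eq_bigr => p _.
rewrite (symP.2 p (f p) theta (fE p)); congr (_ * F _).
by apply/funext => tau; rewrite /kap fE.
Qed.

Variable C : Omega -> Omega -> R.

Local Notation T := (superop P (Phi psi P)).

(** Both tuples enter only through coordinate [i], whose marginal is the counting measure; the total
    sum of [C] remains. *)
Lemma sum_kap_covariance0 i p p' : \sum_a \sum_b C a b = 0 ->
  \sum_tau \sum_tau' kap p tau * kap p' tau' * C (tau i) (tau' i) = 0.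
Proof.
move=> C0.
transitivity (\sum_tau kap p tau * \sum_b C (tau i) b).
  apply: eq_bigr => tau _; rewrite -(sum_kap_fun i p') mulr_sumr.
  by apply: eq_bigr => tau' _; rewrite mulrA.
by rewrite (sum_kap_fun i p (fun a => \sum_b C a b)).
Qed.

(** By permutation invariance [i] and [j] may be taken as the first two coordinates; sorting the
    tuples by their values at the second produces one [Phi] each. *)
Lemma sum_kap_covariance1 i j a b : i != j ->
  \sum_p P p * (\sum_(tau : tup | tau i == a) \sum_(tau' : tup | tau' i == b)
     kap p tau * kap p tau' * C (tau j) (tau' j)) = T C a b.
Proof.
move=> /exists_perm_two [theta [<- <-]] {i j}.
pose F (K : tup -> R) := \sum_(tau : tup | tau (theta ord0) == a)
  \sum_(tau' : tup | tau' (theta ord0) == b)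
     K tau * K tau' * C (tau (theta ord1)) (tau' (theta ord1)).
rewrite -/(F (kap _)) -(sum_kap_perm theta F) /F /superop.
transitivity (\sum_p \sum_c \sum_e P p * (Phi psi P p a c * Phi psi P p b e) * C c e);
  last first.
  rewrite exchange_big; apply: eq_bigr => c _ /=.
  by rewrite exchange_big; apply: eq_bigr => e _ /=; rewrite mulr_suml.
apply: eq_bigr => p _.
have perm_inj' : injective (@permTup Omega k theta).
  move=> t1 t2 /ffunP t12; apply/ffunP => i.
  by have := t12 (theta^-1%g i); rewrite !ffunE permKV.
transitivity (P p * (\sum_(tau : tup | tau ord0 == a) \sum_(tau' : tup | tau' ord0 == b)
     kap p tau * kap p tau' * C (tau ord1) (tau' ord1))).
  congr (_ * _); rewrite [RHS](reindex_inj perm_inj') /=.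
  apply: eq_big => [tau|tau _]; first by rewrite ffunE.
  rewrite [RHS](reindex_inj perm_inj') /=.
  by apply: eq_big => [tau'|tau' _]; rewrite !ffunE.
rewrite (partition_big (fun tau : tup => tau ord1) predT) //= mulr_sumr.
apply: eq_bigr => c _.
transitivity (\sum_(tau : tup | (tau ord0 == a) && (tau ord1 == c))
   P p * kap p tau * \sum_e Phi psi P p b e * C c e).
  rewrite mulr_sumr; apply: eq_bigr => tau /andP[_ /eqP ->].
  rewrite (partition_big (fun tau : tup => tau ord1) predT) //= -mulrA; congr (_ * _).
  rewrite mulr_sumr; apply: eq_bigr => e _; rewrite PhiE mulr_suml mulr_sumr.
  by apply: eq_bigr => tau' /andP[_ /eqP ->]; rewrite mulrA.
rewrite -mulr_suml -mulr_sumr -PhiE mulr_sumr.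
by apply: eq_bigr => e _; ring.
Qed.

Lemma sum_kap_covariance2 i j : i != j ->
  \sum_p P p * (\sum_tau \sum_tau'
     kap p tau * kap p tau' * (C (tau i) (tau' i) * C (tau j) (tau' j))) = dot C (T C).
Proof.
move=> ij; rewrite /dot.
transitivity (\sum_a \sum_b \sum_p C a b * (P p *
  (\sum_(tau : tup | tau i == a) \sum_(tau' : tup | tau' i == b)
     kap p tau * kap p tau' * C (tau j) (tau' j)))); last first.
  by apply: eq_bigr => a _; apply: eq_bigr => b _; rewrite -mulr_sumr sum_kap_covariance1.
under [RHS]eq_bigr => a _ do rewrite exchange_big.
rewrite [RHS]exchange_big; apply: eq_bigr => p _ /=.
rewrite (partition_big (fun tau : tup => tau i) predT) //= mulr_sumr.
apply: eq_bigr => a _.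
transitivity (P p * \sum_(tau : tup | tau i == a) \sum_b \sum_(tau' : tup | tau' i == b)
     C a b * (kap p tau * kap p tau' * C (tau j) (tau' j))).
  congr (_ * _); apply: eq_bigr => tau /eqP ta.
  rewrite (partition_big (fun tau' : tup => tau' i) predT) //=.
  by apply: eq_bigr => b _; apply: eq_bigr => tau' /eqP tb; rewrite ta tb; ring.
rewrite exchange_big mulr_sumr; apply: eq_bigr => b _ /=.
rewrite mulrCA; congr (_ * _); rewrite mulr_sumr; apply: eq_bigr => tau _.
by rewrite mulr_sumr.
Qed.

(** Swapping the first two coordinates transposes [Phi] and preserves the law of the constraint. A
    single [Phi] need not be symmetric. *)
Lemma Phi_sym a b c e :
  \sum_p P p * (Phi psi P p a c * Phi psi P p b e) =
  \sum_p P p * (Phi psi P p c a * Phi psi P p e b).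
Proof.
pose F (K : tup -> R) := (\sum_(tau : tup | (tau ord0 == a) && (tau ord1 == c)) K tau) *
  (\sum_(tau : tup | (tau ord0 == b) && (tau ord1 == e)) K tau).
have -> : \sum_p P p * (Phi psi P p a c * Phi psi P p b e) = \sum_p P p * F (kap p).
  by apply: eq_bigr => p _; rewrite !PhiE.
rewrite -(sum_kap_perm (tperm ord0 ord1) F); apply: eq_bigr => p _.
have tK : involutive (@permTup Omega k (tperm ord0 ord1)).
  by move=> t; apply/ffunP => i; rewrite !ffunE tpermK.
by rewrite !PhiE /F; congr (_ * (_ * _)); rewrite [LHS](reindex_inj (inv_inj tK)) /=;
  apply: eq_big => tau; rewrite ?tK // !ffunE tpermL tpermR andbC.
Qed.

Lemma sum_superop : \sum_a \sum_b C a b = 0 -> \sum_a \sum_b T C a b = 0.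
Proof.
move=> C0; rewrite /superop.
under eq_bigr => a _ do rewrite exchange_big.
rewrite exchange_big -[RHS]C0; apply: eq_bigr => c _ /=.
under eq_bigr => a _ do rewrite exchange_big.
rewrite exchange_big; apply: eq_bigr => e _ /=.
under eq_bigr => a _ do rewrite -mulr_suml.
rewrite -mulr_suml -[RHS]mul1r; congr (_ * _).
under eq_bigr => a _ do rewrite exchange_big.
rewrite exchange_big -[RHS]P_sum; apply: eq_bigr => p _ /=.
under eq_bigr => a _ do rewrite -mulr_sumr -mulr_sumr sum_Phi mulr1.
by rewrite -mulr_sumr sum_Phi mulr1.
Qed.

End Kernel.

(** * Moments of the normalized partition functions *)

Section Sample.
Variables (R : realType) (Omega : finType) (m : nat) (Psi : finType).
Local Notation k := m.+2.
Local Notation tup := {ffun 'I_k -> Omega}.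
Variables (psi : Psi -> tup -> R) (P : Psi -> R).
Hypothesis psiP : standing psi P.
Hypothesis symP : SYM psi P.
Variables (I : finType) (x : I -> Omega -> R).
Hypothesis I_gt0 : (0 < #|I|)%N.
Hypothesis x_mean : forall w, avg (fun i => x i w) = 0.
Hypothesis x_sum : forall i, \sum_w x i w = 0.

Local Notation q := (#|Omega|%:R : R).
Local Notation kap := (kap psi P).
Local Notation T := (superop P (Phi psi P)).

Let P_gt0 p : 0 < P p. Proof. by case: psiP => _ [_ [_ [_ []]]]. Qed.
Let P_sum : \sum_p P p = 1. Proof. by case: psiP => _ [_ [_ [_ [_ []]]]]. Qed.
Let q_neq0 : q != 0. Proof. exact: card_Omega_neq0 psiP. Qed.

Lemma mean_cst (c : R) : q ^- 2 * (\sum_(s : Omega) \sum_(s' : Omega) c) = c.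
Proof.
under eq_bigr => s _ do rewrite sumr_const.
by rewrite sumr_const -mulrnA -[c *+ _]mulr_natl natrM -expr2 mulKf ?expf_neq0.
Qed.

Definition cov (a b : Omega) : R := avg (fun i => x i a * x i b).

Lemma sum_cov : \sum_a \sum_b cov a b = 0.
Proof.
apply: big1 => a _; rewrite -avg_sum /=.
by under eq_avg => i do rewrite -mulr_sumr x_sum mulr0; rewrite avg_cst.
Qed.

(* The factor of one constraint in [Zfirst], divided by [xi], as a polynomial in [eps];
   with [Q] trivial and [w] the identity, [q] times the argument of the second
   [Lambda] of [Bfun], divided by [xi]. *)
Definition branch n (w : 'I_n -> 'I_k) (Q : pred tup) p (s : {ffun 'I_n -> I}) : {poly R} :=
  \sum_(tau : tup | Q tau) kap p tau *: \prod_j (1 + x (s j) (tau (w j)) *: 'X).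

(* The mixed second moment of two branches, a polynomial in [eps ^ 2]. *)
Definition branch_pair n (w : 'I_n -> 'I_k) (Q Q' : pred tup) p : {poly R} :=
  \sum_(tau : tup | Q tau) \sum_(tau' : tup | Q' tau')
    (kap p tau * kap p tau') *: \prod_j (1 + cov (tau (w j)) (tau' (w j)) *: 'X).

Lemma horner_branch n (w : 'I_n -> 'I_k) Q p s e : (branch w Q p s).[e] =
  \sum_(tau : tup | Q tau) kap p tau * \prod_j (1 + e * x (s j) (tau (w j))).
Proof.
rewrite horner_sum; apply: eq_bigr => tau _; rewrite hornerZ horner_prod.
by congr (_ * _); apply: eq_bigr => j _; rewrite !hornerE mulrC.
Qed.

Lemma branch_ge0 n (w : 'I_n -> 'I_k) Q p s e :
  (forall i a, 0 <= 1 + e * x i a) -> 0 <= (branch w Q p s).[e].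
Proof.
move=> e0; rewrite horner_branch; apply: sumr_ge0 => tau _.
by rewrite mulr_ge0 ?(kap_ge0 psiP) // prodr_ge0.
Qed.

Lemma avg_branch n (w : 'I_n -> 'I_k) Q p e :
  avg (fun s => (branch w Q p s).[e]) = \sum_(tau : tup | Q tau) kap p tau.
Proof.
under eq_avg => s do rewrite horner_branch.
rewrite avg_sum; apply: eq_bigr => tau _; rewrite avgZ.
rewrite (avg_prod (fun j i => 1 + e * x i (tau (w j)))) big1 ?mulr1 // => j _.
by rewrite avgD avgZ x_mean mulr0 addr0 avg_cst.
Qed.

(** The samples are independent and centered, so each one contributes [1 + e ^+ 2 * cov] and the
    terms linear in [e] cancel. *)
Lemma avg_branch_pair n (w : 'I_n -> 'I_k) Q Q' p e :
  avg (fun s => (branch w Q p s).[e] * (branch w Q' p s).[e]) =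
  (branch_pair w Q Q' p).[e ^+ 2].
Proof.
transitivity (\sum_(tau : tup | Q tau) \sum_(tau' : tup | Q' tau')
   kap p tau * kap p tau' * avg (fun s : {ffun 'I_n -> I} =>
      \prod_j ((1 + e * x (s j) (tau (w j))) * (1 + e * x (s j) (tau' (w j)))))).
  under eq_avg => s do rewrite !horner_branch mulr_suml.
  rewrite avg_sum; apply: eq_bigr => tau _.
  under eq_avg => s do rewrite mulr_sumr.
  rewrite avg_sum; apply: eq_bigr => tau' _.
  by rewrite -avgZ; apply: eq_avg => s; rewrite big_split /= mulrACA.
rewrite horner_sum; apply: eq_bigr => tau _.
rewrite horner_sum; apply: eq_bigr => tau' _.
rewrite hornerZ horner_prod; congr (_ * _).
rewrite (avg_prod (fun j i => (1 + e * x i (tau (w j))) * (1 + e * x i (tau' (w j))))).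
apply: eq_bigr => j _; rewrite hornerD hornerC hornerZ hornerX.
set a := tau (w j); set b := tau' (w j).
have E i : (1 + e * x i a) * (1 + e * x i b) =
    1 + (e * x i a + (e * x i b + e ^+ 2 * (x i a * x i b))) by ring.
under eq_avg => i do rewrite E.
by rewrite !avgD !avgZ !x_mean avg_cst // !mulr0 !add0r [_ ^+ 2 * _]mulrC.
Qed.

Lemma coef0_branch n (w : 'I_n -> 'I_k) Q p s :
  (branch w Q p s)`_0 = \sum_(tau : tup | Q tau) kap p tau.
Proof.
rewrite coef_sum; apply: eq_bigr => tau _; rewrite coefZ.
by have [-> _ _] := coef_prod1DX (fun j => x (s j) (tau (w j))); rewrite mulr1.
Qed.

Lemma coef1_branch n (w : 'I_n -> 'I_k) Q p s : (branch w Q p s)`_1 =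
  \sum_(tau : tup | Q tau) kap p tau * \sum_j x (s j) (tau (w j)).
Proof.
rewrite coef_sum; apply: eq_bigr => tau _; rewrite coefZ.
by have [_ -> _] := coef_prod1DX (fun j => x (s j) (tau (w j))).
Qed.

Lemma coef0_branch_pair n (w : 'I_n -> 'I_k) Q Q' p : (branch_pair w Q Q' p)`_0 =
  (\sum_(tau : tup | Q tau) kap p tau) * (\sum_(tau : tup | Q' tau) kap p tau).
Proof.
rewrite coef_sum mulr_suml; apply: eq_bigr => tau _.
rewrite coef_sum mulr_sumr; apply: eq_bigr => tau' _; rewrite coefZ.
by have [-> _ _] := coef_prod1DX (fun j => cov (tau (w j)) (tau' (w j))); rewrite mulr1.
Qed.

Lemma coef1_branch_pair n (w : 'I_n -> 'I_k) Q Q' p : (branch_pair w Q Q' p)`_1 =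
  \sum_j \sum_(tau : tup | Q tau) \sum_(tau' : tup | Q' tau')
     kap p tau * kap p tau' * cov (tau (w j)) (tau' (w j)).
Proof.
rewrite coef_sum exchange_big /=; apply: eq_bigr => tau _.
rewrite coef_sum exchange_big /=; apply: eq_bigr => tau' _; rewrite coefZ -mulr_sumr.
by have [_ -> _] := coef_prod1DX (fun j => cov (tau (w j)) (tau' (w j))).
Qed.

Lemma coef2_branch_pair n (w : 'I_n -> 'I_k) Q Q' p : (branch_pair w Q Q' p)`_2 *+ 2 =
  \sum_j \sum_(l | l != j) \sum_(tau : tup | Q tau) \sum_(tau' : tup | Q' tau')
     kap p tau * kap p tau' *
       (cov (tau (w j)) (tau' (w j)) * cov (tau (w l)) (tau' (w l))).
Proof.
under [RHS]eq_bigr => j _ do rewrite exchange_big.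
rewrite coef_sum [RHS]exchange_big -sumrMnl /=; apply: eq_bigr => tau _.
under [RHS]eq_bigr => j _ do rewrite exchange_big.
rewrite coef_sum [RHS]exchange_big -sumrMnl /=; apply: eq_bigr => tau' _.
rewrite coefZ -mulrnAr.
have [_ _ ->] := coef_prod1DX (fun j => cov (tau (w j)) (tau' (w j))).
by rewrite mulr_sumr; apply: eq_bigr => j _; rewrite mulr_sumr.
Qed.

(** Coordinate [lastI] carries the spin of the variable; [wid] enumerates the other [k - 1]
    coordinates. *)
Let lastI : 'I_k := ord_max.
Let wid : 'I_m.+1 -> 'I_k := widen_ord (leqnSn m.+1).

Let wid_last j : lastI != wid j.
Proof. by rewrite -val_eqE /= gtn_eqF. Qed.

Let wid_inj : injective wid.
Proof. by move=> i j /(congr1 val) /= /val_inj. Qed.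

Definition leaf (sigma : Omega) : pred tup := fun tau => tau lastI == sigma.

(** The correlation of the branches of one random constraint at the spins [s] and [s'], in
    [eps ^ 2]; its [g]-th power belongs to [g] independent constraints. *)
Definition Gpoly (s s' : Omega) : {poly R} :=
  \sum_p P p *: branch_pair wid (leaf s) (leaf s') p.

Lemma coef0_Gpoly s s' : (Gpoly s s')`_0 = 1.
Proof.
rewrite coef_sum -[RHS]P_sum; apply: eq_bigr => p _.
by rewrite coefZ coef0_branch_pair !(sum_kap_marginal psiP symP) !mulr1.
Qed.

Lemma coef1_Gpoly s s' : (Gpoly s s')`_1 = m.+1%:R * T cov s s'.
Proof.
rewrite coef_sum.
under eq_bigr => p _ do rewrite coefZ coef1_branch_pair mulr_sumr.
rewrite exchange_big /=.
under eq_bigr => j _ do rewrite (sum_kap_covariance1 psiP symP _ _ _ (wid_last j)).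
by rewrite sumr_const card_ord mulr_natl.
Qed.

Lemma card_neq n (j : 'I_n.+1) : #|[pred l | l != j]| = n.
Proof. by rewrite cardC1 card_ord. Qed.

(** Summing over both spins frees the last coordinate; then each ordered pair of distinct remaining
    coordinates contributes [dot cov (T cov)]. *)
Lemma sum_coef2_Gpoly : \sum_s \sum_s' (Gpoly s s')`_2 *+ 2 =
  m.+1%:R * m%:R * dot cov (T cov).
Proof.
transitivity (\sum_p P p * ((branch_pair wid predT predT p)`_2 *+ 2)).
  transitivity (\sum_p \sum_s \sum_s' P p *
     ((branch_pair wid (leaf s) (leaf s') p)`_2 *+ 2)).
    rewrite [RHS]exchange_big; apply: eq_bigr => s _ /=.
    rewrite [RHS]exchange_big; apply: eq_bigr => s' _ /=.
    by rewrite coef_sum -sumrMnl; apply: eq_bigr => p _; rewrite coefZ mulrnAr.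
  apply: eq_bigr => p _.
  under eq_bigr => s _ do rewrite -mulr_sumr.
  rewrite -mulr_sumr; congr (_ * _).
  under eq_bigr => s _ do rewrite sumrMnl.
  rewrite sumrMnl; congr (_ *+ _).
  under eq_bigr => s _ do rewrite -coef_sum.
  rewrite -coef_sum; congr ((polyseq _)`_2).
  rewrite /branch_pair [RHS](partition_big (fun tau : tup => tau lastI) predT) //=.
  apply: eq_bigr => s _; rewrite exchange_big /=; apply: eq_bigr => tau _.
  by rewrite [RHS](partition_big (fun tau : tup => tau lastI) predT).
under eq_bigr => p _ do rewrite coef2_branch_pair mulr_sumr.
rewrite exchange_big /=.
transitivity (\sum_(j < m.+1) \sum_(l < m.+1 | l != j) dot cov (T cov)).
  apply: eq_bigr => j _.
  under eq_bigr => p _ do rewrite mulr_sumr.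
  rewrite exchange_big /=; apply: eq_bigr => l lj.
  by apply: (sum_kap_covariance2 psiP symP); rewrite (inj_eq wid_inj) eq_sym.
under eq_bigr => j _ do rewrite sumr_const card_neq.
by rewrite sumr_const card_ord -mulrnA mulnC -natrM mulr_natl.
Qed.

(* The second moment of [Upoly] below, as a polynomial in [eps ^ 2]. *)
Definition Hpoly : {poly R} := q ^- 2 *: \sum_p P p *: branch_pair id predT predT p.

Lemma coef0_Hpoly : Hpoly`_0 = 1.
Proof.
rewrite coefZ coef_sum.
under eq_bigr => p _ do rewrite coefZ coef0_branch_pair !(sum_kap psiP symP).
by rewrite -mulr_suml P_sum mul1r -expr2 mulVf // expf_neq0.
Qed.

Lemma coef1_Hpoly : Hpoly`_1 = 0.
Proof.
rewrite coefZ coef_sum big1 ?mulr0 // => p _.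
rewrite coefZ coef1_branch_pair big1 ?mulr0 // => j _.
exact: (sum_kap_covariance0 psiP symP _ _ _ sum_cov).
Qed.

Lemma coef2_Hpoly : Hpoly`_2 *+ 2 = q ^- 2 * (m.+2%:R * m.+1%:R * dot cov (T cov)).
Proof.
rewrite coefZ -mulrnAr; congr (_ * _).
rewrite coef_sum -sumrMnl.
under eq_bigr => p _ do rewrite coefZ -mulrnAr coef2_branch_pair mulr_sumr.
rewrite exchange_big /=.
transitivity (\sum_(j < k) \sum_(l < k | l != j) dot cov (T cov)).
  apply: eq_bigr => j _.
  under eq_bigr => p _ do rewrite mulr_sumr.
  rewrite exchange_big /=; apply: eq_bigr => l lj.
  by apply: (sum_kap_covariance2 psiP symP); rewrite eq_sym.
under eq_bigr => j _ do rewrite sumr_const card_neq.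
by rewrite sumr_const card_ord -mulrnA mulnC -natrM mulr_natl.
Qed.

(* The variance of [Ypoly] below, as a polynomial in [eps ^ 2]. *)
Definition Dpoly g : {poly R} := q ^- 2 *: \sum_s \sum_s' (Gpoly s s' ^+ g - 1).

Lemma coef0_Dpoly g : (Dpoly g)`_0 = 0.
Proof.
rewrite coefZ coef_sum big1 ?mulr0 // => s _; rewrite coef_sum big1 // => s' _.
by rewrite coefB coef1; have [-> _ _] := coef_exp2 g (coef0_Gpoly s s'); rewrite subrr.
Qed.

(** The coefficient is proportional to the total sum of [T cov], which vanishes with that of [cov].
    So the variance starts at order [eps ^ 4]. *)
Lemma coef1_Dpoly g : (Dpoly g)`_1 = 0.
Proof.
rewrite coefZ coef_sum; apply/eqP; rewrite mulf_eq0; apply/orP; right; apply/eqP.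
transitivity (\sum_s \sum_s' g%:R * (m.+1%:R * T cov s s')).
  apply: eq_bigr => s _; rewrite coef_sum; apply: eq_bigr => s' _.
  by rewrite coefB coef1 subr0; have [_ -> _] := coef_exp2 g (coef0_Gpoly s s');
    rewrite coef1_Gpoly.
under eq_bigr => s _ do rewrite -mulr_sumr -mulr_sumr.
by rewrite -!mulr_sumr (sum_superop psiP symP sum_cov) !mulr0.
Qed.

Lemma coef2_Dpoly g : (Dpoly g)`_2 *+ 2 = q ^- 2 *
  (g%:R * (m.+1%:R * m%:R * dot cov (T cov)) +
   g%:R * (g%:R - 1) * (m.+1%:R ^+ 2 * dot (T cov) (T cov))).
Proof.
rewrite coefZ -mulrnAr; congr (_ * _); rewrite coef_sum -sumrMnl.
transitivity (\sum_s \sum_s' (g%:R * ((Gpoly s s')`_2 *+ 2) +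
    g%:R * (g%:R - 1) * (m.+1%:R ^+ 2 * (T cov s s' * T cov s s')))).
  apply: eq_bigr => s _; rewrite coef_sum -sumrMnl; apply: eq_bigr => s' _.
  rewrite coefB coef1 subr0; have [_ _ ->] := coef_exp2 g (coef0_Gpoly s s').
  by rewrite coef1_Gpoly; ring.
under eq_bigr => s _ do rewrite big_split -!mulr_sumr /=.
by rewrite big_split /= -!mulr_sumr sum_coef2_Gpoly.
Qed.

(** The argument of the first [Lambda] divided by [q * xi ^+ g], which gives it mean 1. *)
Definition Ypoly g (ps : {ffun 'I_g -> Psi}) (S : {ffun 'I_g -> {ffun 'I_m.+1 -> I}}) :
    {poly R} :=
  q^-1 *: \sum_sigma \prod_i branch wid (leaf sigma) (ps i) (S i).

Definition Upoly p (s : {ffun 'I_k -> I}) : {poly R} := q^-1 *: branch id predT p s.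

Lemma coef0_Ypoly g (ps : {ffun 'I_g -> Psi}) S : (Ypoly ps S)`_0 = 1.
Proof.
rewrite coefZ coef_sum.
under eq_bigr => s _.
  rewrite coef0_prod => [|i]; last by rewrite coef0_branch (sum_kap_marginal psiP symP).
  over.
by rewrite sumr_const mulVf.
Qed.

(** The sum over the spin of the variable frees the last coordinate, and the marginals reduce each
    term to a coordinate sum of [x], which is zero. Hence the fluctuations have order [eps ^ 2]. *)
Lemma coef1_Ypoly g (ps : {ffun 'I_g -> Psi}) S : (Ypoly ps S)`_1 = 0.
Proof.
rewrite coefZ coef_sum.
under eq_bigr => s _.
  rewrite coef1_prod => [|i]; last by rewrite coef0_branch (sum_kap_marginal psiP symP).
  under eq_bigr => i _ do rewrite coef1_branch.
  over.
rewrite exchange_big /= big1 ?mulr0 // => i _.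
transitivity (\sum_tau kap (ps i) tau * \sum_j x (S i j) (tau (wid j))).
  by rewrite [RHS](partition_big (fun tau : tup => tau lastI) predT).
under eq_bigr => tau _ do rewrite mulr_sumr.
rewrite exchange_big big1 //= => j _.
by rewrite (sum_kap_fun psiP symP (wid j) (ps i) (x (S i j))) x_sum.
Qed.

Lemma coef0_Upoly p s : (Upoly p s)`_0 = 1.
Proof. by rewrite coefZ coef0_branch (sum_kap psiP symP) mulVf. Qed.

Lemma coef1_Upoly p s : (Upoly p s)`_1 = 0.
Proof.
rewrite coefZ coef1_branch.
under eq_bigr => tau _ do rewrite mulr_sumr.
rewrite exchange_big big1 ?mulr0 //= => j _.
by rewrite (sum_kap_fun psiP symP j p (x (s j))) x_sum.
Qed.

(** The expectation given [gamma = g]: constraints drawn from [P], each with a block of [k - 1]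
    uniform samples from [I]. *)
Definition Emix g (F : {ffun 'I_g -> Psi} -> {ffun 'I_g -> {ffun 'I_m.+1 -> I}} -> R) : R :=
  \sum_(ps : {ffun 'I_g -> Psi}) (\prod_i P (ps i)) * avg (F ps).

Lemma EmixD g F1 F2 : Emix (fun ps S => F1 ps S + F2 ps S) = @Emix g F1 + Emix F2.
Proof. by rewrite /Emix -big_split; apply: eq_bigr => ps _; rewrite avgD mulrDr. Qed.

Lemma EmixZ g c F : Emix (fun ps S => c * F ps S) = c * @Emix g F.
Proof. by rewrite /Emix mulr_sumr; apply: eq_bigr => ps _; rewrite avgZ mulrCA. Qed.

Lemma eq_Emix g F1 F2 : (forall ps S, F1 ps S = F2 ps S) -> @Emix g F1 = Emix F2.
Proof.
by move=> F12; apply: eq_bigr => ps _; congr (_ * _); apply: eq_avg => S; exact: F12.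
Qed.

Lemma Emix_sum g (K : finType) F :
  Emix (fun ps S => \sum_(k : K) F k ps S) = \sum_k @Emix g (F k).
Proof.
rewrite /Emix exchange_big; apply: eq_bigr => ps _ /=.
by rewrite avg_sum mulr_sumr.
Qed.

Lemma ler_Emix g F1 F2 : (forall ps S, F1 ps S <= F2 ps S) -> @Emix g F1 <= Emix F2.
Proof.
move=> F12; apply: ler_sum => ps _; rewrite ler_wpM2l ?prodr_ge0 // => [i _|].
  exact: ltW.
by apply: ler_avg => S; exact: F12.
Qed.

Lemma Emix_prod g (h : Psi -> {ffun 'I_m.+1 -> I} -> R) :
  Emix (fun (ps : {ffun 'I_g -> Psi}) S => \prod_i h (ps i) (S i)) =
  (\sum_p P p * avg (h p)) ^+ g.
Proof.
rewrite -[g in RHS]card_ord -prodr_const bigA_distr_bigA /=.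
by apply: eq_bigr => ps _; rewrite [RHS]big_split /= -avg_prod.
Qed.

Lemma Emix_cst g (c : R) : @Emix g (fun _ _ => c) = c.
Proof.
have E1 : @Emix g (fun _ _ => 1) = 1.
  transitivity (Emix (fun (ps : {ffun 'I_g -> Psi}) S => \prod_(i < g) (1 : R))).
    by apply: eq_Emix => ps S; rewrite prodr_const expr1n.
  rewrite (Emix_prod _ (fun _ _ => 1)).
  under eq_bigr => p _ do rewrite avg_cst ?card_ffun ?expn_gt0 ?I_gt0 // mulr1.
  by rewrite P_sum expr1n.
by rewrite -[RHS]mulr1 -[in RHS]E1 -EmixZ; apply: eq_Emix => ps S; rewrite mulr1.
Qed.

Lemma horner_Ypoly g (ps : {ffun 'I_g -> Psi}) S e : (Ypoly ps S).[e] =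
  q^-1 * \sum_sigma \prod_i (branch wid (leaf sigma) (ps i) (S i)).[e].
Proof.
by rewrite hornerZ horner_sum; congr (_ * _); apply: eq_bigr => s _; rewrite horner_prod.
Qed.

Lemma Emix_Ypoly g e : Emix (fun (ps : {ffun 'I_g -> Psi}) S => (Ypoly ps S).[e]) = 1.
Proof.
under eq_Emix => ps S do rewrite horner_Ypoly.
rewrite EmixZ Emix_sum.
under eq_bigr => s _.
  rewrite (Emix_prod _ (fun p S => (branch wid (leaf s) p S).[e])).
  under eq_bigr => p _ do rewrite avg_branch (sum_kap_marginal psiP symP) mulr1.
  rewrite P_sum expr1n; over.
by rewrite sumr_const mulVf.
Qed.

Lemma Emix_Ypoly2 g e :
  Emix (fun (ps : {ffun 'I_g -> Psi}) S => (Ypoly ps S).[e] ^+ 2) =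
  q ^- 2 * \sum_s \sum_s' (Gpoly s s').[e ^+ 2] ^+ g.
Proof.
transitivity (Emix (fun (ps : {ffun 'I_g -> Psi}) S => q ^- 2 * \sum_s \sum_s'
    \prod_i ((branch wid (leaf s) (ps i) (S i)).[e] *
             (branch wid (leaf s') (ps i) (S i)).[e]))).
  apply: eq_Emix => ps S; rewrite horner_Ypoly exprMn exprVn; congr (_ * _).
  rewrite expr2 mulr_suml; apply: eq_bigr => s _; rewrite mulr_sumr.
  by apply: eq_bigr => s' _; rewrite big_split.
rewrite EmixZ Emix_sum; congr (_ * _); apply: eq_bigr => s _.
rewrite Emix_sum; apply: eq_bigr => s' _.
rewrite (Emix_prod _ (fun p S =>
  (branch wid (leaf s) p S).[e] * (branch wid (leaf s') p S).[e])).
congr (_ ^+ _); rewrite horner_sum; apply: eq_bigr => p _.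
by rewrite hornerZ avg_branch_pair.
Qed.

Lemma Emix_Ypoly_var g e :
  Emix (fun (ps : {ffun 'I_g -> Psi}) S => ((Ypoly ps S).[e] - 1) ^+ 2) =
  (Dpoly g).[e ^+ 2].
Proof.
transitivity (Emix (fun (ps : {ffun 'I_g -> Psi}) S =>
    (Ypoly ps S).[e] ^+ 2 + (- 2 * (Ypoly ps S).[e] + 1))).
  by apply: eq_Emix => ps S; ring.
rewrite !EmixD EmixZ Emix_cst Emix_Ypoly Emix_Ypoly2 /Dpoly hornerZ.
have -> : - 2 * 1 + 1 = q ^- 2 * (\sum_(s : Omega) \sum_(s' : Omega) -1) :> R.
  by rewrite mean_cst; ring.
rewrite -mulrDr -big_split horner_sum; congr (_ * _); apply: eq_bigr => s _ /=.
rewrite -big_split horner_sum; apply: eq_bigr => s' _ /=.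
by rewrite hornerD hornerN hornerC horner_exp.
Qed.

Definition entropyY g e : R :=
  Emix (fun (ps : {ffun 'I_g -> Psi}) S => Lambda (Ypoly ps S).[e]).

Lemma Ypoly_ge0 g (ps : {ffun 'I_g -> Psi}) S e :
  (forall i a, 0 <= 1 + e * x i a) -> 0 <= (Ypoly ps S).[e].
Proof.
move=> e0; rewrite horner_Ypoly mulr_ge0 ?invr_ge0 //.
by apply: sumr_ge0 => s _; apply: prodr_ge0 => i _; exact: branch_ge0.
Qed.

(** Below, [Lambda y >= y - 1] and the mean is 1. Above, [Lambda y <= y ^+ 2], and the second moment
    is an average of [g]-th powers of values of [Gpoly]. *)
Lemma entropyY_bounds e : (forall i a, 0 <= 1 + e * x i a) ->
  exists M, forall g, 0 <= entropyY g e <= M ^+ g.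
Proof.
move=> e0; pose N := \sum_s \sum_s' `|(Gpoly s s').[e ^+ 2]|; exists (1 + N) => g.
have N0 : 0 <= N by apply: sumr_ge0 => s _; exact: sumr_ge0.
apply/andP; split.
  have <- : Emix (fun (ps : {ffun 'I_g -> Psi}) S => (Ypoly ps S).[e] + - 1) = 0.
    by rewrite EmixD Emix_Ypoly Emix_cst subrr.
  by apply: ler_Emix => ps S; exact/Lambda_ge/Ypoly_ge0.
apply: (@le_trans _ _ (Emix (fun (ps : {ffun 'I_g -> Psi}) S => (Ypoly ps S).[e] ^+ 2))).
  apply: ler_Emix => ps S; have Y0 := Ypoly_ge0 ps S e0.
  by apply: le_trans (Lambda_le Y0) _; rewrite gerBl.
rewrite Emix_Ypoly2.
rewrite -[leRHS]mean_cst ler_wpM2l ?invr_ge0 ?exprn_ge0 //; apply: ler_sum => s _.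
apply: ler_sum => s' _; apply: le_trans (ler_norm _) _; rewrite normrX lerXn2r ?nnegrE ?addr_ge0 //.
rewrite ler_wpDl // /N (bigD1 s) //= (bigD1 s') //= -addrA lerDl addr_ge0 ?sumr_ge0 //.
by move=> i _; rewrite sumr_ge0.
Qed.

(** In the expansion of [Lambda] at 1 the linear part averages to zero, and the quadratic part gives
    half the variance. *)
Lemma bigO0_entropyY g : bigO0 6 (fun e => entropyY g e - (Dpoly g).[e ^+ 2] / 2).
Proof.
apply: (@bigO0_eq _ _ (fun e => \sum_(ps : {ffun 'I_g -> Psi})
    ((\prod_i P (ps i)) * #|{ffun 'I_g -> {ffun 'I_m.+1 -> I}}|%:R^-1) * \sum_S
   (Lambda (1 + ((Ypoly ps S).[e] - 1)) -
      (((Ypoly ps S).[e] - 1) + ((Ypoly ps S).[e] - 1) ^+ 2 / 2)))).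
  apply: nearW => e.
  have -> : entropyY g e - (Dpoly g).[e ^+ 2] / 2 =
     Emix (fun (ps : {ffun 'I_g -> Psi}) S => Lambda (1 + ((Ypoly ps S).[e] - 1)) +
      ((- 1 * (Ypoly ps S).[e] + 1) + - 2^-1 * ((Ypoly ps S).[e] - 1) ^+ 2)).
    rewrite !EmixD !EmixZ Emix_Ypoly Emix_cst Emix_Ypoly_var mulr1 addNr add0r.
    rewrite mulNr [2^-1 * _]mulrC; congr (_ - _); apply: eq_Emix => ps S.
    by rewrite addrC subrK.
  apply: eq_bigr => ps _; rewrite -mulrA; congr (_ * (_ * _)); apply: eq_bigr => S _.
  by ring.
apply: bigO0_sum => ps; apply: bigO0_scale; apply: bigO0_sum => S.
apply: bigO0_Lambda.
apply: (@bigO0_eq _ _ (fun e => (Ypoly ps S - 1).[e])).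
  by apply: nearW => e; rewrite hornerD hornerN hornerC.
apply: bigO0_horner => -[|[|//]] _; rewrite coefB coef1 ?coef0_Ypoly ?coef1_Ypoly ?subrr //.
Qed.

Definition entropyU e : R := \sum_p P p * avg (fun s => Lambda (Upoly p s).[e]).

Lemma avg_Upoly p e : avg (fun s => (Upoly p s).[e]) = 1.
Proof.
under eq_avg => s do rewrite hornerZ.
by rewrite avgZ avg_branch (sum_kap psiP symP) mulVf.
Qed.

Lemma avg_Upoly2 e : \sum_p P p * avg (fun s => (Upoly p s).[e] ^+ 2) = Hpoly.[e ^+ 2].
Proof.
rewrite hornerZ horner_sum mulr_sumr; apply: eq_bigr => p _.
under eq_avg => s do rewrite hornerZ exprMn exprVn expr2.
by rewrite avgZ avg_branch_pair hornerZ mulrCA.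
Qed.

Lemma bigO0_entropyU : bigO0 6 (fun e => entropyU e - (Hpoly.[e ^+ 2] - 1) / 2).
Proof.
apply: (@bigO0_eq _ _ (fun e => \sum_p
    (P p * #|{ffun 'I_k -> I}|%:R^-1) * \sum_s
   (Lambda (1 + ((Upoly p s).[e] - 1)) -
      (((Upoly p s).[e] - 1) + ((Upoly p s).[e] - 1) ^+ 2 / 2)))).
  apply: nearW => e.
  rewrite -avg_Upoly2 -[X in (_ - X) / _]P_sum -sumrB mulr_suml -sumrB; apply: eq_bigr => p _.
  have -> : P p * avg (fun s => Lambda (Upoly p s).[e]) -
      (P p * avg (fun s => (Upoly p s).[e] ^+ 2) - P p) / 2 =
    P p * avg (fun s => Lambda (1 + ((Upoly p s).[e] - 1)) +
        (- 2^-1 * (Upoly p s).[e] ^+ 2 + 2^-1)).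
    rewrite !avgD avgZ avg_cst ?card_ffun ?expn_gt0 ?I_gt0 //.
    under [in RHS]eq_avg => s do rewrite addrC subrK.
    by field.
  rewrite -mulrA; congr (_ * (_ * _)); apply: eq_bigr => s _.
  by field.
apply: bigO0_sum => p; apply: bigO0_scale; apply: bigO0_sum => s.
apply: bigO0_Lambda.
apply: (@bigO0_eq _ _ (fun e => (Upoly p s - 1).[e])).
  by apply: nearW => e; rewrite hornerD hornerN hornerC.
apply: bigO0_horner => -[|[|//]] _; rewrite coefB coef1 ?coef0_Upoly ?coef1_Upoly ?subrr //.
Qed.

End Sample.

(** * The expansion of the Bethe functional *)

(** Substituting [e ^+ 2] leaves only even degrees, so that degree six follows degree four. *)
Lemma bigO0_horner_sq (R : realType) (p : {poly R}) : p`_0 = 0 -> p`_1 = 0 ->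
  bigO0 6 (fun e => p.[e ^+ 2] - p`_2 * e ^+ 4).
Proof.
move=> p0 p1.
apply: (@bigO0_eq _ _ (fun e => ((p - p`_2 *: 'X^2) \Po 'X^2).[e])).
  apply: nearW => e; rewrite horner_comp hornerD hornerN hornerZ !hornerXn.
  by rewrite -exprM.
apply: bigO0_horner => i i6; rewrite coef_comp_poly_Xn //; case: ifP => // _.
rewrite coefB coefZ coefXn.
have : (i %/ 2 < 3)%N by rewrite ltn_divLR.
by case: (i %/ 2)%N => [|[|[|//]]] _; rewrite ?p0 ?p1 /= ?mulr0 ?mulr1 ?subrr.
Qed.

Section Gap.
Variables (R : realType) (Omega : finType) (m : nat) (Psi : finType).
Local Notation k := m.+2.
Local Notation tup := {ffun 'I_k -> Omega}.
Variables (psi : Psi -> tup -> R) (P : Psi -> R).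
Hypothesis psiP : standing psi P.
Hypothesis symP : SYM psi P.
Variables (I : finType) (x : I -> Omega -> R).
Hypothesis I_gt0 : (0 < #|I|)%N.
Hypothesis x_mean : forall w, avg (fun i => x i w) = 0.
Hypothesis x_sum : forall i, \sum_w x i w = 0.

Local Notation q := (#|Omega|%:R : R).
Local Notation T := (superop P (Phi psi P)).
Local Notation C := (cov x).
Local Notation entropyY := (entropyY psi P x).
Local Notation entropyU := (entropyU psi P x).

Lemma near_perturbation_ge0 : \forall e \near (0 : R)^'+, forall i a, 0 <= 1 + e * x i a.
Proof.
pose N := \sum_i \sum_a `|x i a|.
have N0 : 0 <= N by apply: sumr_ge0 => i _; exact: sumr_ge0.
near=> e => i a.
have e0 : 0 <= e by near: e; exact: nbhs_right_ge.
have eN : e * (N + 1) <= 1.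
  rewrite -ler_pdivlMr ?ltr_wpDl //.
  by near: e; apply: nbhs_right_le; rewrite divr_gt0 // ltr_wpDl.
have xN : `|x i a| <= N.
  rewrite /N (bigD1 i) //= (bigD1 a) //= -addrA lerDl addr_ge0 ?sumr_ge0 //.
  by move=> j _; rewrite sumr_ge0.
have := ler_norm (- x i a); rewrite normrN; nra.
Unshelve. all: by end_near. Qed.

Lemma exists_entropy_gap (d : R) : 0 < d ->
  dot C (T C) < d * m.+1%:R * dot (T C) (T C) ->
  exists G e, (forall i a, 0 <= 1 + e * x i a) /\
    d * m.+1%:R / m.+2%:R * entropyU e < \sum_(g < G) poissonW d g * entropyY g e.
Proof.
move=> d0 gap.
have q0 : 0 < q by rewrite ltr0n (card_Omega_gt0 psiP).
set Q := dot C (T C) in gap *; set N := dot (T C) (T C) in gap.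
(* At order [e ^+ 4], [entropyY g] has the coefficient [g A + g (g - 1) B] and [entropyU] has [h];
   [r] is the weight of [entropyU] once [xi] has cancelled. *)
pose A := q ^- 2 * (m.+1%:R * m%:R * Q) / 4.
pose B := q ^- 2 * (m.+1%:R ^+ 2 * N) / 4.
pose h := q ^- 2 * (m.+2%:R * m.+1%:R * Q) / 4.
pose r := d * m.+1%:R / m.+2%:R.
have D2 g : (Dpoly psi P x g)`_2 = 2 * (g%:R * A + g%:R * (g%:R - 1) * B).
  have := coef2_Dpoly psiP symP x g; rewrite -/Q -/N => E.
  apply: (@mulIf _ (2 : R)); rewrite ?pnatr_eq0 // [LHS]mulr_natr E /A /B.
  by field; rewrite gt_eqF.
have H2 : (Hpoly psi P x)`_2 = 2 * h.
  have := coef2_Hpoly psiP symP x; rewrite -/Q => E.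
  apply: (@mulIf _ (2 : R)); rewrite ?pnatr_eq0 // [LHS]mulr_natr E /h.
  by field; rewrite gt_eqF.
have [G Gt] : exists G, r * h < \sum_(g < G) poissonW d g * (g%:R * A + g%:R * (g%:R - 1) * B).
  apply: exists_poisson_truncation => //; rewrite -subr_gt0.
  (* The multiples of [Q] combine by [(m + 1) m - (m + 1)^2 = - (m + 1)]. *)
  have -> : d * A + d ^+ 2 * B - r * h =
      q ^- 2 * d * m.+1%:R / 4 * (d * m.+1%:R * N - Q).
    rewrite /A /B /h /r -[m.+2%:R]natr1 -[m.+1%:R]natr1.
    by field; rewrite ?gt_eqF // -?addrA ltr_wpDl.
  by rewrite mulr_gt0 ?subr_gt0 // !mulr_gt0 ?invr_gt0 ?exprn_gt0.
exists G; set S := \sum_(g < G) _ in Gt.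
pose f e := \sum_(g < G) poissonW d g * entropyY g e - r * entropyU e.
have fO : bigO0 6 (fun e => f e - (S - r * h) * e ^+ 4).
  apply: (@bigO0_eq _ _ (fun e => \sum_(g < G) poissonW d g *
    ((entropyY g e - (Dpoly psi P x g).[e ^+ 2] / 2) + 2^-1 *
       ((Dpoly psi P x g).[e ^+ 2] - (Dpoly psi P x g)`_2 * e ^+ 4)) +
    (- r) * ((entropyU e - ((Hpoly psi P x).[e ^+ 2] - 1) / 2) + 2^-1 *
       ((Hpoly psi P x - 1).[e ^+ 2] - (Hpoly psi P x - 1)`_2 * e ^+ 4)))).
    apply: nearW => e; rewrite coefB coef1 subr0 H2 hornerD hornerN hornerC.
    transitivity (\sum_(g < G) (poissonW d g * entropyY g e -
        poissonW d g * (g%:R * A + g%:R * (g%:R - 1) * B) * e ^+ 4) -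
      (r * entropyU e - r * h * e ^+ 4)).
      by congr (_ + _); [apply: eq_bigr => g _; rewrite D2|]; field.
    by rewrite sumrB -mulr_suml -/S /f; ring.
  apply: bigO0_add.
    apply: bigO0_sum => g; apply/bigO0_scale/bigO0_add.
      exact: bigO0_entropyY.
    apply/bigO0_scale/bigO0_horner_sq; first exact: coef0_Dpoly.
    exact: coef1_Dpoly.
  apply/bigO0_scale/bigO0_add; first exact: bigO0_entropyU.
  apply/bigO0_scale/bigO0_horner_sq; rewrite coefB coef1.
    by rewrite coef0_Hpoly ?subrr.
  by rewrite coef1_Hpoly ?subrr.
have [e [e1 e2]] : exists e, 0 < f e /\ forall i a, 0 <= 1 + e * x i a.
  apply: (@filter_ex _ (0 : R)^'+).
  apply: filterI near_perturbation_ge0.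
  by apply: bigO0_pos fO; rewrite subr_gt0.
by exists e; split=> //; rewrite -subr_gt0.
Qed.

End Gap.

Lemma iidInt_avg (R : realType) (Omega I : finType) (mu : probability nat R) (X : nat -> I)
    (r : I -> Omega -> R) n (f : seq (Omega -> R) -> R) :
  (forall g : I -> R, Rintegral mu setT (g \o X) = avg g) ->
  iidInt mu (r \o X) n f = iid_avg n (fun s => f [seq r i | i <- s]).
Proof.
move=> HX; elim: n f => [|n IH] f //=.
rewrite -HX; congr Rintegral; apply/funext => t /=.
by rewrite IH.
Qed.

(** * The Bethe functional at a perturbation of the uniform distribution *)

Section Bridge.
Variables (R : realType) (Omega : finType) (m : nat) (Psi : finType).
Local Notation k := m.+2.
Local Notation tup := {ffun 'I_k -> Omega}.
Variables (psi : Psi -> tup -> R) (P : Psi -> R).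
Hypothesis psiP : standing psi P.
Hypothesis symP : SYM psi P.
Variables (I : finType) (x : I -> Omega -> R).
Hypothesis I_gt0 : (0 < #|I|)%N.
Hypothesis x_mean : forall w, avg (fun i => x i w) = 0.
Hypothesis x_sum : forall i, \sum_w x i w = 0.
Variables (mu : probability nat R) (X : nat -> I) (e : R).
Hypothesis muX : forall g : I -> R, Rintegral mu setT (g \o X) = avg g.
Hypothesis e_small : forall i a, 0 <= 1 + e * x i a.

Local Notation q := (#|Omega|%:R : R).
Local Notation xi := (xi psi P).

Let q_gt0 : 0 < q. Proof. by rewrite ltr0n (card_Omega_gt0 psiP). Qed.
Let xi_gt0 : 0 < xi. Proof. exact: xi_gt0 psiP. Qed.
Let P_sum : \sum_p P p = 1. Proof. by case: psiP => _ [_ [_ [_ [_ []]]]]. Qed.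

Definition perturbation (i : I) (a : Omega) : R := (1 + e * x i a) / q.

Lemma perturbation_P2star : P2star mu (perturbation \o X).
Proof.
split; [|split] => [t|w|w] //=.
- split=> [w|]; first by rewrite divr_ge0 // ltW.
  rewrite /perturbation -mulr_suml big_split /= -mulr_sumr x_sum mulr0 addr0.
  by rewrite sumr_const divff // gt_eqF.
- rewrite (muX (fun i => perturbation i w)) /perturbation.
  transitivity (avg (fun i : I => q^-1 * (1 + e * x i w))).
    by apply: eq_avg => i; rewrite mulrC.
  by rewrite avgZ avgD avgZ x_mean avg_cst // mulr0 addr0 mulr1.
Qed.

Lemma sum_perturbation n (w : 'I_n -> 'I_k) (Q : pred tup) p (s : {ffun 'I_n -> I}) :
  \sum_(tau : tup | Q tau) psi p tau * \prod_j perturbation (s j) (tau (w j)) =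
  q ^+ m.+1 * xi / q ^+ n * (branch psi P x w Q p s).[e].
Proof.
rewrite horner_branch mulr_sumr; apply: eq_bigr => tau _.
rewrite /perturbation big_split /= prodr_const card_ord exprVn /kap.
by field; rewrite !expf_neq0 ?gt_eqF.
Qed.

(** The [m.+1] samples at a constraint contribute [q ^- m.+1], which cancels the power of [q] in
    [kap] and leaves one [xi] per constraint; the remaining [q] undoes the average over spins in
    [Ypoly]. *)
Lemma Zfirst_perturbation g (ps : {ffun 'I_g -> Psi})
    (S : {ffun 'I_g -> {ffun 'I_m.+1 -> I}}) :
  Zfirst psi ps [seq perturbation i | i <- flatten [seq codom (fun_of_fin s) | s <- codom S]] =
  xi ^+ g * q * (Ypoly psi P x ps S).[e].
Proof.
rewrite horner_Ypoly mulrA mulfK ?gt_eqF // /Zfirst mulr_sumr.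
apply: eq_bigr => sigma _.
rewrite -[g in xi ^+ g]card_ord -prodr_const -big_split; apply: eq_bigr => i _ /=.
transitivity (q ^+ m.+1 * xi / q ^+ m.+1 *
    (branch psi P x (widen_ord (leqnSn m.+1)) (leaf sigma) (ps i) (S i)).[e]); last first.
  by congr (_ * _); field; rewrite expf_neq0 ?gt_eqF.
rewrite -sum_perturbation; apply: eq_big => [tau|tau _].
  apply/existsP/idP => [[j /andP[/eqP jl]]|tl].
    by rewrite /leaf (_ : j = ord_max) //; apply/val_inj.
  by exists ord_max; rewrite eqxx.
(* Of the [k] indices only the last is excluded, which leaves the [k - 1] samples of block [i]. *)
congr (_ * _); rewrite big_mkcond big_ord_recr /= ltnn mulr1.
by apply: eq_bigr => j _; rewrite ltn_ord nth_flatten_codom.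
Qed.

(** [LambdaM] splits off the logarithm of [xi ^+ g * q]; it is multiplied by [Ypoly], whose mean is
    1. *)
Lemma Bfirst_perturbation d g : Bfirst_g psi P mu (perturbation \o X) d g =
  poissonW d g * (g%:R * ln xi + ln q + entropyY psi P x g e).
Proof.
rewrite /Bfirst_g; congr (_ * _).
transitivity (Emix P (fun (ps : {ffun 'I_g -> Psi}) (S : {ffun 'I_g -> {ffun 'I_m.+1 -> I}}) =>
   Lambda (Ypoly psi P x ps S).[e] +
     (g%:R * ln xi + ln q) * (Ypoly psi P x ps S).[e])); last first.
  by rewrite EmixD EmixZ Emix_Ypoly // mulr1 addrC.
apply: eq_bigr => ps _; congr (_ * _).
rewrite (iidInt_avg _ _ _ muX) iid_avg_block iid_avgE; apply: eq_avg => S.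
have xg : 0 < xi ^+ g by rewrite exprn_gt0.
rewrite Zfirst_perturbation LambdaM ?mulr_gt0 ?Ypoly_ge0 //.
rewrite lnM ?posrE // lnXn //.
by rewrite -[ln xi *+ g]mulr_natl; field; rewrite !gt_eqF.
Qed.

Lemma Bsecond_perturbation p :
  iidInt mu (perturbation \o X) k (fun s => Lambda (\sum_(tau : tup)
          psi p tau * \prod_(j : 'I_k) (nth (fun _ => 0) s j) (tau j))) =
  xi * ln xi + xi * avg (fun s => Lambda (Upoly psi P x p s).[e]).
Proof.
rewrite (iidInt_avg _ _ _ muX) iid_avgE.
transitivity (avg (fun s : {ffun 'I_k -> I} => xi * Lambda (Upoly psi P x p s).[e] +
    xi * ln xi * (Upoly psi P x p s).[e])); last first.
  by rewrite avgD !avgZ avg_Upoly // mulr1 addrC.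
apply: eq_avg => s.
have -> : \sum_(tau : tup) psi p tau *
    \prod_(j < k) nth (fun=> 0) [seq perturbation i | i <- codom s] j (tau j) =
    xi * (Upoly psi P x p s).[e].
  transitivity (\sum_(tau : tup) psi p tau * \prod_j perturbation (s j) (tau (id j))).
    apply: eq_bigr => tau _; congr (_ * _); apply: eq_bigr => j _.
    rewrite (nth_map (s j)) ?size_codom ?card_ord //.
    by rewrite (nth_map j) ?size_enum_ord // nth_ord_enum.
  rewrite sum_perturbation hornerZ [RHS]mulrA; congr (_ * _).
  by rewrite [q ^+ k]exprS; field; rewrite expf_neq0 ?gt_eqF.
rewrite LambdaM //; first by ring.
rewrite hornerZ mulr_ge0 ?invr_ge0 ?(ltW q_gt0) //; exact: branch_ge0.
Qed.

Lemma Bfun_perturbation_gt d G : 0 < d ->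
  d * m.+1%:R / m.+2%:R * entropyU psi P x e <
    \sum_(g < G) poissonW d g * entropyY psi P x g e ->
  Bfun psi P mu (perturbation \o X) d > ln q + d / k%:R * ln xi.
Proof.
move=> d0 gap; rewrite /Bfun.
rewrite (_ : Bfirst_g _ _ _ _ _ = fun g =>
  poissonW d g * (g%:R * ln xi + ln q + entropyY psi P x g e)); last first.
  by apply/funext => g; exact: Bfirst_perturbation.
under eq_bigr => p _ do rewrite Bsecond_perturbation mulrDr.
rewrite big_split /= -mulr_suml P_sum mul1r.
have -> : \sum_p P p * (xi * avg (fun s => Lambda (Upoly psi P x p s).[e])) =
    xi * entropyU psi P x e.
  by rewrite /entropyU mulr_sumr; apply: eq_bigr => p _; rewrite mulrCA.
have [M HM] := entropyY_bounds psiP symP I_gt0 x_mean e_small.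
have := poisson_limn_ge d0 (ln xi) (ln q) G HM.
set L := limn _ => HL.
rewrite ltrBrDr; apply: lt_le_trans HL.
(* The Poisson mean puts [d * ln xi] into the first term, and the second removes its fraction
   [(k - 1) / k]. *)
have -> : ln q + d / k%:R * ln xi + d * k.-1%:R / (k%:R * xi) *
    (xi * ln xi + xi * entropyU psi P x e) =
  d * ln xi + ln q + d * m.+1%:R / m.+2%:R * entropyU psi P x e.
  rewrite /= -[m.+2%:R]natr1; field.
  by rewrite gt_eqF //= gt_eqF // ltr_wpDl.
by rewrite ltrD2l.
Qed.

End Bridge.

(** * Condensation above the Kesten-Stigum bound *)

Section Condensation.
Variables (R : realType) (Omega : finType) (m : nat) (Psi : finType).
Local Notation k := m.+2.
Variables (psi : Psi -> {ffun 'I_k -> Omega} -> R) (P : Psi -> R).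
Hypothesis psiP : standing psi P.
Hypothesis symP : SYM psi P.

Local Notation q := (#|Omega|%:R : R).
Local Notation T := (superop P (Phi psi P)).

Let P_gt0 p : 0 < P p. Proof. by case: psiP => _ [_ [_ [_ []]]]. Qed.

(* A Gram matrix is realized as the covariance of [+- u j] with a uniform index
   and an independent uniform sign. *)
Lemma exists_Bfun_gt (d : R) (z : Omega -> Omega -> R) : 0 < d ->
  gram z -> dot z (T z) < d * m.+1%:R * dot (T z) (T z) ->
  exists (mu : probability nat R) (rho : nat -> Omega -> R),
    P2star mu rho /\ Bfun psi P mu rho d > ln q + d / k%:R * ln (xi psi P).
Proof.
move=> d0 [J [u [u0 uz]]] gap.
(* An empty [J] means [z = 0], against the strict inequality [gap]. *)
have [j0|J0] := pickP (fun _ : J => true); last first.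
  have z0 : z = fun a b => 0 * z a b.
    by apply/funext => a; apply/funext => b; rewrite mul0r uz big_pred0.
  by move: gap; rewrite z0 superopZ !dotZ !mul0r mulr0 ltxx.
move=> _.
pose I := (J * bool)%type; pose x (i : I) a : R := (-1) ^+ i.2 * u i.1 a.
have I0 : (0 < #|{: I}|)%N by apply/card_gt0P; exists (j0, true).
have sum_bool (F : I -> R) : \sum_i F i = \sum_j (F (j, true) + F (j, false)).
  rewrite (eq_bigr (fun i => F (i.1, i.2))) => [|[]//].
  rewrite -(pair_bigA _ (fun j b => F (j, b))) /=.
  by apply: eq_bigr => j _; rewrite big_bool.
have x_mean w : avg (fun i => x i w) = 0.
  rewrite /avg sum_bool big1 ?mulr0 // => j _.
  by rewrite /x expr1 expr0 mul1r mulN1r addNr.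
have x_sum i : \sum_w x i w = 0 by rewrite /x -mulr_sumr u0 mulr0.
(* The covariance is [z] divided by [#|J|], half the size of [I]; both sides of [gap] are quadratic
   in [z], so the factor cancels. *)
pose s : R := #|{: I}|%:R^-1 * 2.
have s0 : 0 < s by rewrite mulr_gt0 // invr_gt0 ltr0n.
have covE : cov x = fun a b => s * z a b.
  apply/funext => a; apply/funext => b; rewrite /cov /avg sum_bool /s -mulrA.
  congr (_ * _); rewrite uz mulr_sumr; apply: eq_bigr => j _.
  by rewrite /x expr1 expr0; ring.
have [|G [e [e_small lt_e]]] :=
    exists_entropy_gap psiP symP I0 x_mean x_sum d0.
  rewrite covE superopZ !dotZ.
  by rewrite [d * _ * (_ * _)]mulrCA ltr_pM2l // mulr_gt0.
have [mu [X muX]] := exists_uniform_law R (j0, true).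
exists mu, (perturbation x e \o X); split.
  exact: (perturbation_P2star psiP I0 x_mean x_sum muX e_small).
exact: (Bfun_perturbation_gt psiP symP I0 x_mean muX e_small d0 lt_e).
Qed.

Lemma inE_sums (z : Omega -> Omega -> R) : Defs.inE z ->
  (forall a, \sum_b z a b = 0) /\ (forall b, \sum_a z a b = 0).
Proof.
move=> zE; split=> c.
- have [_] := zE (fun i => (i == c)%:R); rewrite (bigD1 c) //= [X in _ + X]big1 => [|i ic].
    by rewrite addr0; under eq_bigr => b _ do rewrite eqxx !mulr1.
  by apply: big1 => b _; rewrite (negbTE ic) mul0r mulr0.
- have [+ _] := zE (fun i => (i == c)%:R); rewrite exchange_big (bigD1 c) //=.
  rewrite [X in _ + X]big1 => [|i ic].
    by rewrite addr0; under eq_bigr => a _ do rewrite eqxx !mulr1.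
  by apply: big1 => b _; rewrite (negbTE ic) mulr0 mulr0.
Qed.

Lemma unitNormE (z : Omega -> Omega -> R) : unitNorm z -> dot z z = 1.
Proof. by move=> <-; apply: eq_bigr => a _; apply: eq_bigr => b _; rewrite expr2. Qed.

Lemma XiQuadE (z : Omega -> Omega -> R) : XiQuad psi P z = dot z (T z).
Proof.
rewrite dotC; apply: eq_bigr => a _; apply: eq_bigr => b _.
by rewrite mulr_suml; apply: eq_bigr => c _; rewrite mulr_suml.
Qed.

(** Apply [exists_gram_supercritical] with [c = d (k - 1)]; the law built from its Gram matrix puts
    [d] into the set defining [d_cond]. *)
Lemma d_cond_le_of_supercritical (d : R) (z : Omega -> Omega -> R) : 0 < d ->
  Defs.inE z -> unitNorm z -> 1 < d * m.+1%:R * XiQuad psi P z ->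
  (d_cond psi P <= d%:E)%E.
Proof.
move=> d0 /inE_sums[z0r z0c] /unitNormE z1 zgt.
rewrite XiQuadE in zgt.
have [|y gy gap] := exists_gram_supercritical (fun p => ltW (P_gt0 p))
    (sum_Phi psiP symP) (Phi_sym psiP symP) (card_Omega_gt0 psiP) z0r z0c z1 _ zgt.
  by rewrite mulr_gt0.
have [mu [rho [rhoP rhoB]]] := exists_Bfun_gt d0 gy gap.
apply: ereal_inf_lbound; exists d => //; split=> //.
by exists _, _, mu, rho.
Qed.

(** Entries of a unit vector are at most 1 in modulus. This excludes the case in which [d_KS] takes
    the value 0. *)
Lemma maxXi_lty : (maxXi psi P < +oo)%E.
Proof.
pose K := \sum_a \sum_b \sum_c \sum_e
  `|\sum_p P p * (Phi psi P p a c * Phi psi P p b e)|.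
apply: (@le_lt_trans _ _ K%:E); last exact: ltry.
apply: ge_ereal_sup => _ [z [_ z1] <-]; rewrite lee_fin.
have z_le1 a b : `|z a b| <= 1.
  rewrite -(@ler_pXn2r _ 2) ?nnegrE // expr1n real_normK ?num_real // -z1.
  rewrite (bigD1 a) //= (bigD1 b) //= -addrA lerDl addr_ge0 ?sumr_ge0 // => i _.
    exact: sqr_ge0.
  by apply: sumr_ge0 => j _; exact: sqr_ge0.
apply: ler_sum => a _; apply: ler_sum => b _; apply: ler_sum => c _; apply: ler_sum => e _.
apply: le_trans (ler_norm _) _; rewrite !normrM -mulrA ler_piMr //.
by rewrite mulr_ile1.
Qed.

(** The normalized [centering] is admissible, and its value is a product of two Gram matrices. It is
    nonzero since it dominates a unit vector of the space, which exists when the supremum is not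
    [-oo]. *)
Lemma maxXi_ge0 : (maxXi psi P != -oo)%E -> (0 <= maxXi psi P)%E.
Proof.
move=> maxN.
have [z [zE z1]] : exists z : Omega -> Omega -> R, Defs.inE z /\ unitNorm z.
  apply: contrapT => h; move/negP: maxN; apply.
  rewrite /maxXi (_ : [set x | _] = set0) ?image_set0 ?ereal_sup0 //.
  by apply/seteqP; split => // z /= zP; apply: h; exists z.
have O0 := card_Omega_gt0 psiP.
have [z0r z0c] := inE_sums zE.
pose c : Omega -> Omega -> R := @centering R Omega.
have gc : gram c := @gram_centering R Omega O0.
have tr : 1 <= q * \sum_a c a a.
  have z11 := unitNormE z1.
  by rewrite -[leLHS]z11; apply: (dominated_dot_le z11 (unit_dominated O0 z0r z0c z11) gc).
have q0 : 0 < q by rewrite ltr0n.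
have tr0 : 0 < \sum_a c a a by rewrite -(pmulr_rgt0 _ q0) (lt_le_trans ltr01).
have N0 : 0 < dot c c.
  by rewrite -(pmulr_rgt0 _ q0); apply: lt_le_trans (gram_trace_le c); rewrite exprn_gt0.
pose s := (Num.sqrt (dot c c))^-1.
have s2 : s * s * dot c c = 1.
  by rewrite -expr2 exprVn sqr_sqrtr ?ltW // mulVf // gt_eqF.
apply: (@le_trans _ _ (XiQuad psi P (fun a b => s * c a b))%:E).
  rewrite lee_fin XiQuadE superopZ dotZ -expr2 mulr_ge0 ?sqr_ge0 //.
  apply: dot_gram_ge0 => //.
  exact: (superop_gram (fun p => ltW (P_gt0 p)) (sum_Phi psiP symP)).
apply: ereal_sup_ubound; exists (fun a b => s * c a b) => //; split=> /=.
  have cr a : \sum_b c a b = 0 by exact: sum_centering.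
  move=> y; split.
    rewrite exchange_big big1 // => b _ /=.
    rewrite -mulr_suml -mulr_sumr.
    by under eq_bigr => a _ do rewrite /c centering_sym; rewrite cr mulr0 mul0r.
  by apply: big1 => a _; rewrite -mulr_suml -mulr_sumr cr mulr0 mul0r.
rewrite /unitNorm -[RHS]s2 -dotZ; apply: eq_bigr => a _; apply: eq_bigr => b _.
by rewrite expr2.
Qed.

Lemma d_cond_le_d_KS : (d_cond psi P <= d_KS psi P)%E.
Proof.
have := maxXi_lty; have := maxXi_ge0; rewrite /d_KS.
have : (forall a : R, (a%:E < maxXi psi P)%E -> exists z : Omega -> Omega -> R,
    [/\ Defs.inE z, unitNorm z & a < XiQuad psi P z]).
  move=> a /ereal_sup_gt[_ [z [zE z1] <-]]; rewrite lte_fin => az.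
  by exists z.
case: (maxXi psi P) => [M||] //= H; last by rewrite leey.
move=> /(_ isT); rewrite lee_fin => M0 _.
case: eqVneq => [_|M_neq0]; first by rewrite leey.
have {}M0 : 0 < M by rewrite lt_neqAle eq_sym M_neq0.
apply/lee_addgt0Pr => e e0; rewrite -EFinD.
set d := _ + e.
have k0 : 0 < m.+1%:R :> R by [].
have d0 : 0 < d by rewrite addr_gt0 // invr_gt0 mulr_gt0.
have [|z [zE z1 zgt]] := H (d * m.+1%:R)^-1.
  rewrite lte_fin -[M]invrK ltf_pV2 ?posrE ?mulr_gt0 ?invr_gt0 //.
  rewrite -ltr_pdivrMr // /d mulrC -invfM ltrDl //.
apply: (d_cond_le_of_supercritical d0 zE z1).
by rewrite -ltr_pdivrMl ?mulr_gt0 // mulr1.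
Qed.

End Condensation.

Theorem mainTheorem6 (R : realType) (Omega : finType) (k : nat) (Psi : finType)
  (psi : Psi -> {ffun 'I_k -> Omega} -> R) (P : Psi -> R) :
  standing psi P -> SYM psi P -> BAL psi P ->
  (d_cond psi P <= d_KS psi P)%E.
Proof.
case: k psi => [|[|m]] psi psiP symP _; [by case: psiP|by case: psiP|].
exact: d_cond_le_d_KS.
Qed.
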